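(* Under the standing setting, if $f_0=f_\infty=\infty$, then there exist $\lambda^*\in(0,\infty)$ and $m^*\in(0,\infty)$ such that: for every $\lambda\in(0,\lambda^* )$ problem (P$_\lambda$) has two positive solutions $u_1(\lambda),u_2(\lambda)$ with $0<\|u_1(\lambda)\|_\infty<m^*<\|u_2(\lambda)\|_\infty$, which can be chosen so that $\lim_{\lambda\to0^+}\|u_1(\lambda)\|_\infty=0$ and $\lim_{\lambda\to0^+}\|u_2(\lambda)\|_\infty=\infty$; and problem (P$_{\lambda^*}$) has a positive solution.
   Context: Standing setting. $\varphi:\mathbb{R}\to\mathbb{R}$ is an odd, increasing homeomorphism satisfying condition (A): there exist increasing homeomorphisms $\psi_1,\psi_2:[0,\infty)\to[0,\infty)$ such that $\varphi(x)\psi_1(y)\le \varphi(xy)\le \varphi(x)\psi_2(y)$ for all $x,y\ge 0$. Let $c,d\in C([0,1],(0,\infty))$, and $\|\cdot\|_\infty$ the maximum norm on $C[0,1]$. Let $f\in C([0,\infty),[0,\infty))$ with $f(s)>0$ for $s>0$, and write $f_0=\lim_{s\to0^+}f(s)/\varphi(s)$, $f_\infty=\lim_{s\to\infty}f(s)/\varphi(s)$ (assumed to exist in $[0,\infty]$ whenever referred to). Let $h\in C((0,1),[0,\infty))$, $h\not\equiv 0$, with $\int_0^{1/2}\psi_1^{-1}\big(\int_s^{1/2}h(\tau)d\tau\big)ds+\int_{1/2}^1\psi_1^{-1}\big(\int_{1/2}^s h(\tau)d\tau\big)ds<\infty$. Notation attached to $h$: $\alpha_h=\sup\{x\in(0,1):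 h=0 \text{ on }(0,x)\}$ ($0$ if empty); $\beta_h=\inf\{x\in(0,1): h=0\text{ on }(x,1)\}$ ($1$ if empty); $\bar\alpha_h=\sup\{x\in(\alpha_h,1]: h>0 \text{ on }(\alpha_h,x)\}$; $\bar\beta_h=\inf\{x\in[0,\beta_h): h>0\text{ on }(x,\beta_h)\}$; $\gamma_h^1=(3\alpha_h+\bar\alpha_h)/4$, $\gamma_h^2=(\bar\beta_h+3\beta_h)/4$. It is assumed that $0\le\alpha_h<\gamma_h^1<\gamma_h^2<\beta_h\le 1$. For $\lambda\ge0$, problem (P$_\lambda$) is: $(d(t)\varphi(c(t)u'(t)))'+\lambda h(t)f(u(t))=0$ for $t\in(0,1)$, $u(0)=u(1)=0$. A solution is $u\in C[0,1]\cap C^1(0,1)$ such that $t\mapsto d(t)\varphi(c(t)u'(t))$ is continuously differentiable on $(0,1)$ and the equation and boundary conditions hold; it is positive if $u(t)>0$ for all $t\in(0,1)$. *)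

(* Defs.v *)
From Stdlib Require Import Reals Lra Classical ClassicalEpsilon.
Open Scope R_scope.

(** Supremum of a set of reals (0 if it has no least upper bound,
    e.g. if it is empty or unbounded). *)
Definition sup_of (E : R -> Prop) : R :=
  match excluded_middle_informative (exists m, is_lub E m) with
  | left H => proj1_sig (constructive_indefinite_description _ H)
  | right _ => 0
  end.

Definition inf_of (E : R -> Prop) : R := - sup_of (fun y => E (- y)).

(** Riemann integral of f over [a,b] (0 if f is not Riemann integrable). *)
Definition Rint (f : R -> R) (a b : R) : R :=
  match excluded_middle_informative (exists pr : Riemann_integrable f a b, True) with
  | left H => RiemannInt (proj1_sig (constructive_indefinite_description _ H))
  | right _ => 0
  end.

Definition cont_on (D : R -> Prop) (f : R -> R) : Prop :=
  forall x, D x -> limit1_in f D (f x) x.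

Definition sup_norm (u : R -> R) : R :=
  sup_of (fun y => exists t, 0 <= t <= 1 /\ y = Rabs (u t)).

Definition odd_inc_homeo (phi : R -> R) : Prop :=
  (forall x, phi (- x) = - phi x) /\
  (forall x y, x < y -> phi x < phi y) /\
  continuity phi /\
  (forall y, exists x, phi x = y).

Definition inc_homeo_pos (p : R -> R) : Prop :=
  (forall x, 0 <= x -> 0 <= p x) /\
  (forall x y, 0 <= x -> x < y -> p x < p y) /\
  cont_on (fun x => 0 <= x) p /\
  (forall y, 0 <= y -> exists x, 0 <= x /\ p x = y).

Definition condA (phi psi1 psi2 : R -> R) : Prop :=
  forall x y, 0 <= x -> 0 <= y ->
    phi x * psi1 y <= phi (x * y) /\ phi (x * y) <= phi x * psi2 y.

Definition f0_infinite (f phi : R -> R) : Prop :=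
  forall M, exists delta, 0 < delta /\ forall s, 0 < s < delta -> M < f s / phi s.

Definition finf_infinite (f phi : R -> R) : Prop :=
  forall M, exists S, forall s, S < s -> M < f s / phi s.

(** Finiteness of the improper integral over (0,1/2] of a nonnegative g. *)
Definition impr_int_finite_left (g : R -> R) (a b : R) : Prop :=
  exists M, forall e, a < e <= b -> Rint g e b <= M.
(** Finiteness of the improper integral over [1/2,1) of a nonnegative g. *)
Definition impr_int_finite_right (g : R -> R) (a b : R) : Prop :=
  exists M, forall e, a <= e < b -> Rint g a e <= M.

Definition alpha_h (h : R -> R) : R :=
  let E := fun x => 0 < x < 1 /\ forall t, 0 < t < x -> h t = 0 in
  match excluded_middle_informative (exists x, E x) with
  | left _ => sup_of E | right _ => 0 end.

Definition beta_h (h : R -> R) : R :=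
  let E := fun x => 0 < x < 1 /\ forall t, x < t < 1 -> h t = 0 in
  match excluded_middle_informative (exists x, E x) with
  | left _ => inf_of E | right _ => 1 end.

Definition alphabar_h (h : R -> R) : R :=
  sup_of (fun x => alpha_h h < x <= 1 /\ forall t, alpha_h h < t < x -> 0 < h t).

Definition betabar_h (h : R -> R) : R :=
  inf_of (fun x => 0 <= x < beta_h h /\ forall t, x < t < beta_h h -> 0 < h t).

Definition gamma1_h (h : R -> R) : R := (3 * alpha_h h + alphabar_h h) / 4.
Definition gamma2_h (h : R -> R) : R := (betabar_h h + 3 * beta_h h) / 4.

Definition standing (phi psi1 psi2 psi1inv c d f h : R -> R) : Prop :=
  odd_inc_homeo phi /\
  inc_homeo_pos psi1 /\ inc_homeo_pos psi2 /\ condA phi psi1 psi2 /\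
  (forall y, 0 <= y -> 0 <= psi1inv y /\ psi1 (psi1inv y) = y) /\
  cont_on (fun t => 0 <= t <= 1) c /\ (forall t, 0 <= t <= 1 -> 0 < c t) /\
  cont_on (fun t => 0 <= t <= 1) d /\ (forall t, 0 <= t <= 1 -> 0 < d t) /\
  cont_on (fun s => 0 <= s) f /\ (forall s, 0 <= s -> 0 <= f s) /\
  (forall s, 0 < s -> 0 < f s) /\
  cont_on (fun t => 0 < t < 1) h /\ (forall t, 0 < t < 1 -> 0 <= h t) /\
  (exists t, 0 < t < 1 /\ h t <> 0) /\
  impr_int_finite_left (fun s => psi1inv (Rint h s (1/2))) 0 (1/2) /\
  impr_int_finite_right (fun s => psi1inv (Rint h (1/2) s)) (1/2) 1 /\
  0 <= alpha_h h /\ alpha_h h < gamma1_h h /\ gamma1_h h < gamma2_h h /\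
  gamma2_h h < beta_h h /\ beta_h h <= 1.

Definition is_solution (phi c d h f : R -> R) (lam : R) (u : R -> R) : Prop :=
  cont_on (fun t => 0 <= t <= 1) u /\
  exists u' : R -> R,
    (forall t, 0 < t < 1 -> derivable_pt_lim u t (u' t)) /\
    (forall t, 0 < t < 1 -> continuity_pt u' t) /\
    exists w' : R -> R,
      (forall t, 0 < t < 1 ->
         derivable_pt_lim (fun s => d s * phi (c s * u' s)) t (w' t)) /\
      (forall t, 0 < t < 1 -> continuity_pt w' t) /\
      (forall t, 0 < t < 1 -> w' t + lam * h t * f (u t) = 0) /\
      u 0 = 0 /\ u 1 = 0.

Definition is_pos_solution (phi c d h f : R -> R) (lam : R) (u : R -> R) : Prop :=
  is_solution phi c d h f lam u /\ forall t, 0 < t < 1 -> 0 < u t.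

(* Main.v *)
Require Import Defs.
From Stdlib Require Import Reals ZArith Lra Lia Classical ClassicalEpsilon.
From mathcomp.classical Require filter.
From Coquelicot Require Import Coquelicot.
Open Scope R_scope.

(** The equation is the first-order system [u' = phi^{-1}(v/d)/c], [v' = - lam h f(u)], which
    is discretised on [K = 2n+1] cells and solved by shooting in the initial flux [s]. The
    discrete endpoint value [u_K(s)] and the maximum [m(s)] are continuous in [s] without any
    Lipschitz condition, so the intermediate value theorem replaces a fixed-point index. By the
    integrability of [h], a trajectory with [u_K <= 0] and maximum at most [M] satisfies
    [m <= C phi^{-1}(2 lam B / d0)], where [B] bounds [f] on [0,M]; for small [lam] this forces
    [u_K > 0] whenever [m = 1]. On the other hand [f/phi] is large near [0] and near infinity, and
    a Harnack inequality for trajectories then forces [u_K < 0] when [m] is a small [r] or a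
    large [R]. Hence [u_K] has zeros with [r <= m <= 1] and with [1 <= m <= R]. Both families of
    discrete solutions are bounded, and equicontinuous on compact subsets of [(0,1)], so their
    pointwise limits along an ultrafilter exist and solve the system. The bound on [m] in terms
    of [lam] survives in the limit, up to the Harnack factor, and gives the asymptotics. *)

(** * Limits along an ultrafilter *)

(** Two obstacles shape the proof. As [f] is only continuous, initial value problems may have
    several solutions and continuous shooting may be multivalued; an explicit recursion on a grid is
    single-valued. As [h] need not be integrable up to 0 and 1, the flux may blow up there; so [h]
    is only integrated over cells centred at interior nodes, fluxes are bounded only in the
    interior, and the boundary values are recovered from sums of [psi1inv] of tail masses. The
    halves of condition (A) act separately: the lower one ([psi1]) gives the Harnack constant and
    brings in the integrability condition, the upper one ([psi2]) makes overshooting scale-free, so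
    that one lower bound on f/phi serves near 0 and near infinity. The levels r and R depend on lam
    and give no asymptotics. Large norms come from the bound on m once more: a root with 1 <= m <= y
    would have m < 1 as soon as lam is small relative to a bound of f on [0,y]. *)

Record nonprincipal_ultrafilter (G : (nat -> Prop) -> Prop) : Prop := {
  ultra_mono : forall P Q : nat -> Prop, G P -> (forall n, P n -> Q n) -> G Q;
  ultra_and : forall P Q : nat -> Prop, G P -> G Q -> G (fun n => P n /\ Q n);
  ultra_em : forall P : nat -> Prop, G P \/ G (fun n => ~ P n);
  ultra_ex : forall P : nat -> Prop, G P -> exists n, P n;
  ultra_ge : forall N : nat, G (fun n => (N <= n)%nat) }.

(** The filter of the sets containing a tail is extended by the ultrafilter lemma; [ultra_ge] is
    inherited from it. *)
Lemma nonprincipal_ultrafilter_ex : exists G, nonprincipal_ultrafilter G.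
Proof.
  pose (F := fun P : nat -> Prop => exists N, forall n, (N <= n)%nat -> P n).
  assert (PF : filter.ProperFilter F).
  { split.
    - intros [N HN]. exact (HN N (le_n N)).
    - split.
      + exists 0%nat. intros n _. exact I.
      + intros P Q [N HN] [N' HN']. exists (N + N')%nat. intros n Hn.
        split; [apply HN | apply HN']; lia.
      + intros P Q HPQ [N HN]. exists N. intros n Hn. apply HPQ, HN, Hn. }
  destruct (@filter.ultraFilterLemma nat F PF) as [G [HG HFG]].
  assert (PG : filter.ProperFilter G) by exact (@filter.ultra_proper _ _ HG).
  exists G. split.
  - intros P Q HP HPQ. exact (@filter.filterS nat G _ P Q HPQ HP).
  - intros P Q HP HQ. exact (@filter.filterI nat G _ P Q HP HQ).
  - intros P. exact (@filter.in_ultra_setVsetC _ G P HG).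
  - intros P HP. exact (@filter.filter_ex _ G PG P HP).
  - intros N. apply HFG. exists N. auto.
Qed.

(** A single [G] gives every bounded sequence a limit, so limits at all points of [0,1] are taken at
    once, without subsequences or a diagonal argument. *)
Definition tends (G : (nat -> Prop) -> Prop) (x : nat -> R) (l : R) : Prop :=
  forall e, 0 < e -> G (fun n => Rabs (x n - l) < e).

Section Ultralimits.

Context (G : (nat -> Prop) -> Prop) (HG : nonprincipal_ultrafilter G).

Lemma ultra_all (P : nat -> Prop) : (forall n, P n) -> G P.
Proof.
  intros H. apply (ultra_mono _ HG _ _ (ultra_ge _ HG 0)). auto.
Qed.

(** The limit is the supremum of the levels lying below [x n] for [G]-many [n]; by the ultrafilter
    dichotomy every level is below or above the sequence on a set of [G]. *)
Lemma tends_bounded (x : nat -> R) (B : R) :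
  G (fun n => Rabs (x n) <= B) -> exists l, tends G x l.
Proof.
  intros HB.
  destruct (completeness (fun y => G (fun n => y <= x n))) as [l [Hub Hlub]].
  - exists B. intros y Hy.
    destruct (ultra_ex _ HG _ (ultra_and _ HG _ _ HB Hy)) as [n [H1 H2]].
    generalize (Rle_abs (x n)). lra.
  - exists (- B). apply (ultra_mono _ HG _ _ HB). intros n Hn.
    generalize (Rle_abs (- x n)). rewrite Rabs_Ropp. lra.
  - exists l. intros e He.
    assert (H1 : G (fun n => x n < l + e)).
    { destruct (ultra_em _ HG (fun n => x n < l + e)) as [H | H]; [exact H | exfalso].
      assert (l + e <= l); [apply Hub | lra].
      apply (ultra_mono _ HG _ _ H). intros n Hn. lra. }
    assert (H2 : G (fun n => l - e < x n)).
    { destruct (ultra_em _ HG (fun n => l - e < x n)) as [H | H]; [exact H | exfalso].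
      assert (l <= l - e); [apply Hlub | lra].
      intros y Hy. destruct (ultra_ex _ HG _ (ultra_and _ HG _ _ H Hy)) as [n [Ha Hb]]. lra. }
    apply (ultra_mono _ HG _ _ (ultra_and _ HG _ _ H1 H2)).
    intros n [Ha Hb]. apply Rabs_def1; lra.
Qed.

Lemma tends_const (l : R) : tends G (fun _ => l) l.
Proof.
  intros e He. apply ultra_all. intros n. rewrite Rminus_diag, Rabs_R0. exact He.
Qed.

Lemma tends_squeeze (x : nat -> R) (l C : R) :
  G (fun n => Rabs (x n - l) <= C / (2 * INR n + 1)) -> tends G x l.
Proof.
  intros H e He.
  destruct (nfloor_ex (Rabs C / e)) as [N [_ HN]].
  { apply Rdiv_le_0_compat; [apply Rabs_pos | exact He]. }
  apply (ultra_mono _ HG _ _ (ultra_and _ HG _ _ H (ultra_ge _ HG (S N)))).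
  intros n [H1 H2]. apply Rle_lt_trans with (1 := H1).
  apply le_INR in H2. rewrite S_INR in H2.
  assert (0 <= INR N) by apply pos_INR.
  apply Rlt_div_l; [lra |].
  apply (Rlt_div_l _ _ _ He) in HN. generalize (Rle_abs C). nra.
Qed.

Lemma tends_scal (x : nat -> R) (a k : R) :
  tends G x a -> tends G (fun n => k * x n) (k * a).
Proof.
  intros Hx e He.
  assert (Hk : 0 < Rabs k + 1) by (generalize (Rabs_pos k); lra).
  apply (ultra_mono _ HG _ _ (Hx (e / (Rabs k + 1)) ltac:(apply Rdiv_lt_0_compat; lra))).
  intros n Hn. rewrite <- Rmult_minus_distr_l, Rabs_mult.
  apply (Rlt_div_r _ _ _ Hk) in Hn. generalize (Rabs_pos k) (Rabs_pos (x n - a)). nra.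
Qed.

Lemma tends_minus (x y : nat -> R) (a b : R) :
  tends G x a -> tends G y b -> tends G (fun n => x n - y n) (a - b).
Proof.
  intros Hx Hy e He.
  apply (ultra_mono _ HG _ _ (ultra_and _ HG _ _ (Hx (e / 2) ltac:(lra)) (Hy (e / 2) ltac:(lra)))).
  intros n [H1 H2]. apply Rabs_def2 in H1. apply Rabs_def2 in H2. apply Rabs_def1; lra.
Qed.

Lemma tends_le (x y : nat -> R) (a b : R) :
  tends G x a -> tends G y b -> G (fun n => x n <= y n) -> a <= b.
Proof.
  intros Hx Hy H. apply Rnot_lt_le. intros Hlt.
  destruct (ultra_ex _ HG _ (ultra_and _ HG _ _ H
    (ultra_and _ HG _ _ (Hx ((a - b) / 2) ltac:(lra)) (Hy ((a - b) / 2) ltac:(lra)))))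
    as [n [H1 [H2 H3]]].
  apply Rabs_def2 in H2. apply Rabs_def2 in H3. lra.
Qed.

End Ultralimits.

(** * Discrete trajectories *)

Lemma telescope_ge (u : nat -> R) (D : R) (p q : nat) :
  (p <= q)%nat -> (forall j, (p <= j < q)%nat -> D <= u (S j) - u j) ->
  (INR q - INR p) * D <= u q - u p.
Proof.
  intros Hpq. induction Hpq as [|q Hpq IH]; intros H; [lra |].
  rewrite S_INR. generalize (H q ltac:(lia)) (IH (fun j Hj => H j ltac:(lia))). nra.
Qed.

Lemma telescope_le (u : nat -> R) (D : R) (p q : nat) :
  (p <= q)%nat -> (forall j, (p <= j < q)%nat -> u (S j) - u j <= D) ->
  u q - u p <= (INR q - INR p) * D.
Proof.
  intros Hpq. induction Hpq as [|q Hpq IH]; intros H; [lra |].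
  rewrite S_INR. generalize (H q ltac:(lia)) (IH (fun j Hj => H j ltac:(lia))). nra.
Qed.

Fixpoint rsum (F : nat -> R) (m : nat) : R :=
  match m with O => 0 | S k => rsum F k + F k end.

Lemma telescope_rsum (u F : nat -> R) (m : nat) :
  (forall j, (j < m)%nat -> u (S j) - u j <= F j) -> u m - u O <= rsum F m.
Proof.
  induction m as [|m IH]; intros H; simpl; [lra |].
  generalize (H m ltac:(lia)) (IH (fun j Hj => H j ltac:(lia))). lra.
Qed.

Lemma rsum_affine (F : nat -> R) (d a b : R) (m : nat) :
  rsum (fun j => d * (a + b * F j)) m = INR m * d * a + b * rsum (fun j => d * F j) m.
Proof.
  induction m as [|m IH]; [simpl; ring |].
  rewrite S_INR. simpl rsum. rewrite IH. ring.
Qed.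

(** [u] lives on the nodes [0..K] and the flux [v] on the cells [0..K-1], so that
    reversing the grid exchanges [v j] with [- v (K-1-j)] and every one-sided
    estimate below also yields its mirror image. *)
Record chain (gl gu : R -> R) (K : nat) (del : R) (u v : nat -> R) : Prop := {
  chain_up : forall j, (j < K)%nat -> 0 <= v j ->
    del * gl (v j) <= u (S j) - u j <= del * gu (v j);
  chain_down : forall j, (j < K)%nat -> v j <= 0 ->
    del * gl (- v j) <= u j - u (S j) <= del * gu (- v j);
  chain_decr : forall j, (S j < K)%nat -> v (S j) <= v j }.

Lemma chain_rev gl gu K del u v :
  chain gl gu K del u v ->
  chain gl gu K del (fun j => u (K - j)%nat) (fun j => - v (K - 1 - j)%nat).
Proof.
  intros [Hu Hd Hm]. split.
  - intros j Hj Hv. generalize (Hd (K - 1 - j)%nat ltac:(lia) ltac:(lra)).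
    replace (S (K - 1 - j)) with (K - j)%nat by lia.
    replace (K - S j)%nat with (K - 1 - j)%nat by lia. auto.
  - intros j Hj Hv. generalize (Hu (K - 1 - j)%nat ltac:(lia) ltac:(lra)).
    replace (S (K - 1 - j)) with (K - j)%nat by lia.
    replace (K - S j)%nat with (K - 1 - j)%nat by lia.
    rewrite Ropp_involutive. auto.
  - intros j Hj. generalize (Hm (K - 1 - S j)%nat ltac:(lia)).
    replace (S (K - 1 - S j)) with (K - 1 - j)%nat by lia. lra.
Qed.

Section Chains.

Context (gl gu : R -> R) (K0 : R).
Context (gl_mono : forall x y, 0 <= x <= y -> gl x <= gl y).
Context (gu_mono : forall x y, 0 <= x <= y -> gu x <= gu y).
Context (gl_ge0 : forall x, 0 <= x -> 0 <= gl x).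
Context (gu_ge0 : forall x, 0 <= x -> 0 <= gu x).
Context (K0_ge0 : 0 <= K0).
Context (gu_gl : forall x, 0 <= x -> gu x <= K0 * gl x).

Context (K : nat) (del : R) (del_ge0 : 0 <= del).

Lemma chain_anti u v : chain gl gu K del u v ->
  forall i j, (i <= j < K)%nat -> v j <= v i.
Proof.
  intros C i j [Hij HjK]. induction Hij as [|j Hij IH]; [lra |].
  generalize (chain_decr _ _ _ _ _ _ C j HjK) (IH ltac:(lia)). lra.
Qed.

(** Fluxes decrease along the grid, so each of the [S k] cells up to [k] carries flux at least
    [v k]: the discrete form of concavity. *)
Lemma chain_rise u v k : chain gl gu K del u v -> (k < K)%nat -> 0 <= v k ->
  INR (S k) * (del * gl (v k)) <= u (S k) - u O.
Proof.
  intros C Hk Hv. replace (INR (S k)) with (INR (S k) - INR 0) by (simpl; ring).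
  apply telescope_ge; [lia |]. intros j Hj.
  assert (Hvj : v k <= v j) by (apply (chain_anti u v C); lia).
  destruct (chain_up _ _ _ _ _ _ C j ltac:(lia) ltac:(lra)) as [H _].
  assert (gl (v k) <= gl (v j)) by (apply gl_mono; lra). nra.
Qed.

(** A node preceded by a nonnegative flux lies above the left end by [chain_rise]; otherwise the
    flux after it is negative too, and the reversed trajectory puts the node above the right end. *)
Lemma chain_ge0 u v k : chain gl gu K del u v -> (k <= K)%nat ->
  0 <= u O -> 0 <= u K -> 0 <= u k.
Proof.
  assert (Hhalf : forall u v k, chain gl gu K del u v -> (S k <= K)%nat -> 0 <= v k ->
      u O <= u (S k)).
  { intros u' v' k' C Hk Hv. generalize (chain_rise u' v' k' C ltac:(lia) Hv).
    assert (0 <= del * gl (v' k')) by (apply Rmult_le_pos; auto).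
    generalize (pos_INR (S k')). nra. }
  intros C Hk H0 HK. destruct k as [|k]; [exact H0 |].
  destruct (Rle_lt_dec 0 (v k)) as [Hv | Hv].
  - generalize (Hhalf u v k C Hk Hv). lra.
  - destruct (chain_down _ _ _ _ _ _ C k ltac:(lia) ltac:(lra)) as [Hd _].
    destruct (Nat.eq_dec (S k) K) as [-> | Hne]; [exact HK |].
    generalize (Hhalf _ _ (K - S (S k))%nat (chain_rev _ _ _ _ _ _ C) ltac:(lia)).
    cbv beta. rewrite Nat.sub_0_r.
    replace (K - S (K - S (S k)))%nat with (S k) by lia.
    replace (K - 1 - (K - S (S k)))%nat with (S k) by lia.
    generalize (chain_decr _ _ _ _ _ _ C k ltac:(lia)). lra.
Qed.

(** With [v k] nonnegative, the growth after [k] is at most [INR K * (del * gu (v k))], while the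
    rise before [k] is already [INR k * (del * gl (v k))]; [gu_gl] compares the two. With [v k]
    negative the trajectory only descends after [k]. *)
Lemma chain_harnack_right u v k m : chain gl gu K del u v -> (forall j, (j <= K)%nat -> 0 <= u j) ->
  (0 < k <= m)%nat -> (m <= K)%nat ->
  INR k * u m <= (INR k + K0 * INR K) * u k.
Proof.
  intros C Hu Hk Hm.
  assert (Hkp : 0 <= INR k) by apply pos_INR.
  assert (HKp : 0 <= INR K) by apply pos_INR.
  destruct (Nat.eq_dec k m) as [<- | Hne].
  { generalize (Hu k ltac:(lia)) (Rmult_le_pos _ _ K0_ge0 HKp). nra. }
  destruct (Rle_lt_dec 0 (v k)) as [Hv | Hv].
  - assert (H1 : u m - u k <= (INR m - INR k) * (del * gu (v k))).
    { apply telescope_le; [lia |]. intros j Hj.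
      assert (Hvj : v j <= v k) by (apply (chain_anti u v C); lia).
      assert (0 <= gu (v k)) by (apply gu_ge0; lra).
      destruct (Rle_lt_dec 0 (v j)) as [Hj0 | Hj0].
      - destruct (chain_up _ _ _ _ _ _ C j ltac:(lia) ltac:(lra)) as [_ H'].
        assert (gu (v j) <= gu (v k)) by (apply gu_mono; lra). nra.
      - destruct (chain_down _ _ _ _ _ _ C j ltac:(lia) ltac:(lra)) as [H' _].
        assert (0 <= gl (- v j)) by (apply gl_ge0; lra). nra. }
    assert (H2 : INR k * (del * gl (v k)) <= u k).
    (* [chain_rise] bounds a node by the flux on the cell before it, and that flux dominates the one
       on the cell after it. *)
    { destruct k as [|k]; [lia |].
      assert (Hv' : v (S k) <= v k) by (apply (chain_anti u v C); lia).
      generalize (chain_rise u v k C ltac:(lia) ltac:(lra)) (Hu O ltac:(lia)).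
      assert (gl (v (S k)) <= gl (v k)) by (apply gl_mono; lra).
      generalize (Rmult_le_compat_l (INR (S k) * del) _ _ (Rmult_le_pos _ _ Hkp del_ge0) H). lra. }
    assert (H3 : (INR m - INR k) * (del * gu (v k)) <= INR K * (K0 * (del * gl (v k)))).
    { apply le_INR in Hm. destruct Hk as [_ Hkm]. apply le_INR in Hkm.
      assert (Hd : 0 <= del * gu (v k)) by (apply Rmult_le_pos; auto).
      apply Rle_trans with (INR K * (del * gu (v k))); [nra |].
      apply Rmult_le_compat_l; [exact HKp |].
      generalize (Rmult_le_compat_l del _ _ del_ge0 (gu_gl (v k) Hv)). lra. }
    assert (H4 : INR k * (INR K * (K0 * (del * gl (v k)))) <= INR K * K0 * u k).
    { generalize (Rmult_le_compat_l (INR K * K0) _ _ (Rmult_le_pos _ _ HKp K0_ge0) H2). lra. }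
    generalize (Rmult_le_compat_l (INR k) _ _ Hkp H1) (Rmult_le_compat_l (INR k) _ _ Hkp H3). lra.
  - assert (H1 : u m - u k <= (INR m - INR k) * 0).
    { apply telescope_le; [lia |]. intros j Hj.
      assert (Hvj : v j <= v k) by (apply (chain_anti u v C); lia).
      destruct (chain_down _ _ _ _ _ _ C j ltac:(lia) ltac:(lra)) as [H' _].
      assert (0 <= gl (- v j)) by (apply gl_ge0; lra). nra. }
    generalize (Hu k ltac:(lia)) (Rmult_le_pos _ _ K0_ge0 HKp). nra.
Qed.

(** Discrete counterpart of the bound of a concave nonnegative function from below
    by a multiple of its maximum away from the endpoints. *)
Lemma chain_harnack u v a k m : chain gl gu K del u v -> (forall j, (j <= K)%nat -> 0 <= u j) ->
  0 < a -> a * INR K <= INR k -> a * INR K <= INR K - INR k ->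
  (0 < k < K)%nat -> (m <= K)%nat -> u m <= (1 + K0 / a) * u k.
Proof.
  intros C Hu Ha Hka HkK Hk Hm.
  assert (HKp : 0 < INR K) by (apply lt_0_INR; lia).
  assert (Hfin : forall x M, 0 < x -> a * INR K <= x -> 0 <= u k ->
     x * M <= (x + K0 * INR K) * u k -> M <= (1 + K0 / a) * u k).
  { intros x M Hx Hax Huk H.
    apply Rmult_le_reg_l with (1 := Hx). apply Rle_trans with (1 := H).
    replace (x * ((1 + K0 / a) * u k)) with ((x + K0 * (x / a)) * u k) by (field; lra).
    apply Rmult_le_compat_r; [exact Huk |]. apply Rplus_le_compat_l, Rmult_le_compat_l; [exact K0_ge0 |].
    apply (Rle_div_r _ _ _ Ha). lra. }
  destruct (Nat.le_ge_cases k m) as [Hkm | Hkm].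
  - apply (Hfin (INR k)); [apply lt_0_INR; lia | exact Hka | apply Hu; lia |].
    apply (chain_harnack_right u v k m C Hu); lia.
  - apply (Hfin (INR K - INR k));
      [rewrite <- minus_INR by lia; apply lt_0_INR; lia | exact HkK | apply Hu; lia |].
    generalize (chain_harnack_right _ _ (K - k) (K - m) (chain_rev _ _ _ _ _ _ C)
      (fun j Hj => Hu (K - j)%nat ltac:(lia)) ltac:(lia) ltac:(lia)).
    cbv beta. rewrite minus_INR by lia.
    replace (K - (K - m))%nat with m by lia. replace (K - (K - k))%nat with k by lia. auto.
Qed.

(** One of the two fluxes is at least [D/2] in absolute value, on the side where [u] rises
    from the boundary. *)
Lemma chain_flux_drop u v p q D a : chain gl gu K del u v -> 0 <= u O -> 0 <= u K ->
  0 <= D -> (p < q < K)%nat -> v p - v q >= D ->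
  a <= INR (S p) * del -> a <= INR (K - q) * del ->
  exists k, (k <= K)%nat /\ a * gl (D / 2) <= u k.
Proof.
  intros C H0 HK HD Hpq Hdrop Hp Hq.
  assert (Haux : forall u v p, chain gl gu K del u v -> 0 <= u O -> (p < K)%nat ->
     a <= INR (S p) * del -> D / 2 <= v p -> a * gl (D / 2) <= u (S p)).
  { clear u v p q C H0 HK Hpq Hdrop Hp Hq.
    intros u v p C H0 Hp Ha Hv.
    generalize (chain_rise u v p C Hp ltac:(lra)).
    assert (gl (D / 2) <= gl (v p)) by (apply gl_mono; lra).
    assert (0 <= gl (D / 2)) by (apply gl_ge0; lra).
    assert (0 <= INR (S p) * del) by (apply Rmult_le_pos; [apply pos_INR | exact del_ge0]).
    generalize (Rmult_le_compat_l _ _ _ H2 H). generalize (Rmult_le_compat_r _ _ _ H1 Ha). lra. }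
  destruct (Rle_lt_dec (D / 2) (v p)) as [Hv | Hv].
  - exists (S p). split; [lia |]. apply (Haux u v p C); auto; lia.
  - exists q. split; [lia |].
    generalize (Haux _ _ (K - 1 - q)%nat (chain_rev _ _ _ _ _ _ C)).
    cbv beta. rewrite Nat.sub_0_r.
    replace (K - 1 - (K - 1 - q))%nat with q by lia.
    replace (S (K - 1 - q)) with (K - q)%nat by lia.
    replace (K - (K - q))%nat with q by lia.
    intros H. apply H; auto; [lia | lra].
Qed.

(** A flux above [x] on cell [k] would, by [chain_rise], carry node [S k] beyond [Rm]. *)
Lemma chain_flux_bound u v Rm k x : chain gl gu K del u v ->
  (forall j, (j <= K)%nat -> 0 <= u j <= Rm) -> (k < K)%nat -> 0 <= x ->
  Rm < INR (S k) * del * gl x -> v k <= x.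
Proof.
  intros C Hu Hk Hx H. apply Rnot_lt_le. intros Hlt.
  generalize (chain_rise u v k C Hk ltac:(lra)) (Hu O ltac:(lia)) (Hu (S k) ltac:(lia)).
  assert (gl x <= gl (v k)) by (apply gl_mono; lra).
  assert (0 <= INR (S k) * del) by (apply Rmult_le_pos; [apply pos_INR | exact del_ge0]).
  generalize (Rmult_le_compat_l _ _ _ H1 H0). lra.
Qed.

Lemma chain_flux_bound_abs u v Rm k x y : chain gl gu K del u v ->
  (forall j, (j <= K)%nat -> 0 <= u j <= Rm) -> (k < K)%nat -> 0 <= x ->
  0 <= y -> y <= INR (S k) * del -> y <= INR (K - k) * del ->
  Rm < y * gl x -> Rabs (v k) <= x.
Proof.
  intros C Hu Hk Hx Hy H1 H2 H. assert (Hg : 0 <= gl x) by auto.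
  apply Rabs_le. split.
  - generalize (chain_flux_bound _ _ Rm (K - 1 - k)%nat x (chain_rev _ _ _ _ _ _ C)
      (fun j Hj => Hu (K - j)%nat ltac:(lia)) ltac:(lia) Hx). cbv beta.
    replace (K - 1 - (K - 1 - k))%nat with k by lia.
    replace (S (K - 1 - k)) with (K - k)%nat by lia. intros H'.
    generalize (Rmult_le_compat_r _ _ _ Hg H2). lra.
  - apply (chain_flux_bound u v Rm k x C Hu Hk Hx).
    generalize (Rmult_le_compat_r _ _ _ Hg H1). lra.
Qed.

(** Cells with negative flux only lower [u] and are covered by [0 <= F j], so the flux is compared
    with [F] only where it is nonnegative. *)
Lemma chain_upper u v F m : chain gl gu K del u v -> (m <= K)%nat ->
  (forall j, (j < m)%nat -> 0 <= v j -> gu (v j) <= F j) ->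
  (forall j, (j < m)%nat -> 0 <= F j) ->
  u m - u O <= rsum (fun j => del * F j) m.
Proof.
  intros C Hm HF HF0. apply telescope_rsum. intros j Hj.
  destruct (Rle_lt_dec 0 (v j)) as [Hv | Hv].
  - destruct (chain_up _ _ _ _ _ _ C j ltac:(lia) Hv) as [_ H].
    generalize (Rmult_le_compat_l _ _ _ del_ge0 (HF j Hj Hv)). lra.
  - destruct (chain_down _ _ _ _ _ _ C j ltac:(lia) ltac:(lra)) as [H _].
    generalize (Rmult_le_pos _ _ del_ge0 (gl_ge0 (- v j) ltac:(lra))) (Rmult_le_pos _ _ del_ge0 (HF0 j Hj)).
    lra.
Qed.

End Chains.

(** * The weight and its integrability condition *)

Lemma Rint_RInt (f : R -> R) (a b : R) : ex_RInt f a b -> Rint f a b = RInt f a b.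
Proof.
  intros H. unfold Rint. destruct (excluded_middle_informative _) as [E | E].
  - symmetry. apply RInt_Reals.
  - exfalso. apply E. exists (ex_RInt_Reals_0 _ _ _ H). exact I.
Qed.

Lemma is_RInt_reflect (f : R -> R) (a b l : R) :
  is_RInt f a b l -> is_RInt (fun t => f (1 - t)) (1 - b) (1 - a) l.
Proof.
  intros H.
  assert (H1 : is_RInt (fun y => scal (-1) (f (-1 * y + 1))) (1 - a) (1 - b) l).
  { apply (is_RInt_comp_lin (V := R_NormedModule) f (-1) 1).
    replace (-1 * (1 - a) + 1) with a by ring. replace (-1 * (1 - b) + 1) with b by ring.
    exact H. }
  apply is_RInt_swap in H1. apply is_RInt_opp in H1. rewrite opp_opp in H1.
  revert H1. apply is_RInt_ext. intros x _.
  unfold opp, scal; simpl. unfold mult; simpl. replace (-1 * x + 1) with (1 - x) by ring. ring.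
Qed.

Lemma RInt_reflect (f : R -> R) (a b : R) :
  ex_RInt f a b -> RInt (fun t => f (1 - t)) (1 - b) (1 - a) = RInt f a b.
Proof. intros H. apply is_RInt_unique, is_RInt_reflect.
  apply (RInt_correct (V := R_CompleteNormedModule)), H. Qed.

(** [cont_on] takes limits within the set; the radius is cut so that the whole ball lies in (0,1),
    which gives plain continuity. *)
Lemma cont_on_open (h : R -> R) :
  cont_on (fun t => 0 < t < 1) h -> forall t, 0 < t < 1 -> continuity_pt h t.
Proof.
  intros H t Ht. intros e He. destruct (H t Ht e He) as [a [Ha H']].
  exists (Rmin a (Rmin t (1 - t))). split; [repeat apply Rmin_glb_lt; lra |].
  intros y [Hy1 Hy2]. apply H'. simpl in *. unfold R_dist in *.
  generalize (Rmin_l a (Rmin t (1 - t))) (Rmin_r a (Rmin t (1 - t))) (Rmin_l t (1 - t)) (Rmin_r t (1 - t)).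
  intros. split; [| lra]. apply Rabs_def2 in Hy2. lra.
Qed.

(** The interval is centred at node [j], dual to the cells that carry the fluxes. For [0 < j < K] it
    stays away from 0 and 1, where [h] may fail to be integrable. *)
Definition cell_mass (h : R -> R) (K j : nat) : R :=
  RInt h ((INR j - 1 / 2) / INR K) ((INR j + 1 / 2) / INR K).

(** The number of cells is odd, so the midpoint of flux cell [n] is exactly 1/2; for [j <= n] this
    is the sum of the cell masses at the nodes [j + 1] to [n], and it vanishes for [j = n]. *)
Definition half_mass (h : R -> R) (n j : nat) : R :=
  RInt h ((INR j + 1 / 2) / INR (2 * n + 1)) (1 / 2).

Lemma INR_odd (n : nat) : INR (2 * n + 1) = 2 * INR n + 1.
Proof. rewrite plus_INR, mult_INR. simpl. ring. Qed.

Section Weight.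

Context (h : R -> R) (h_cont : forall t, 0 < t < 1 -> continuity_pt h t).
Context (h_ge0 : forall t, 0 < t < 1 -> 0 <= h t).

Lemma weight_ex_RInt a b : 0 < a < 1 -> 0 < b < 1 -> ex_RInt h a b.
Proof.
  intros Ha Hb. apply (ex_RInt_continuous (V := R_CompleteNormedModule)).
  intros z Hz. apply continuity_pt_filterlim, h_cont.
  revert Hz. unfold Rmin, Rmax. destruct (Rle_dec a b); lra.
Qed.

Lemma weight_RInt_ge0 a b : 0 < a <= b -> b < 1 -> 0 <= RInt h a b.
Proof.
  intros Ha Hb. apply RInt_ge_0; [lra | apply weight_ex_RInt; lra |].
  intros x Hx. apply h_ge0. lra.
Qed.

Lemma weight_Chasles a b c : 0 < a < 1 -> 0 < b < 1 -> 0 < c < 1 ->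
  RInt h a b + RInt h b c = RInt h a c.
Proof. intros Ha Hb Hc. apply (RInt_Chasles h); apply weight_ex_RInt; assumption. Qed.

Lemma cell_interval K j : (0 < j < K)%nat ->
  0 < (INR j - 1 / 2) / INR K <= (INR j + 1 / 2) / INR K /\ (INR j + 1 / 2) / INR K < 1 /\
  (INR j + 1 / 2) / INR K - (INR j - 1 / 2) / INR K = / INR K.
Proof.
  intros [Hj HK]. apply le_INR in Hj. apply le_INR in HK.
  rewrite S_INR in Hj, HK. simpl in Hj. repeat split.
  - apply Rdiv_lt_0_compat; lra.
  - apply Rmult_le_compat_r; [apply Rlt_le, Rinv_0_lt_compat |]; lra.
  - apply Rlt_div_l; lra.
  - field. lra.
Qed.

Lemma cell_mass_bounds K j lo hi : (0 < j < K)%nat ->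
  (forall t, (INR j - 1 / 2) / INR K <= t <= (INR j + 1 / 2) / INR K -> lo <= h t <= hi) ->
  / INR K * lo <= cell_mass h K j <= / INR K * hi.
Proof.
  intros Hj H. destruct (cell_interval K j Hj) as [H1 [H2 H3]]. unfold cell_mass.
  set (a := (INR j - 1 / 2) / INR K) in *. set (b := (INR j + 1 / 2) / INR K) in *.
  assert (Hc : forall c : R, RInt (fun _ => c) a b = / INR K * c).
  { intros c. rewrite (RInt_const (V := R_CompleteNormedModule)).
    rewrite H3. reflexivity. }
  split; rewrite <- Hc; apply RInt_le;
    try (apply weight_ex_RInt; lra); try apply ex_RInt_const; try lra;
    intros x Hx; destruct (H x ltac:(lra)); lra.
Qed.

Lemma cell_mass_ge0 K j : (0 < j < K)%nat -> 0 <= cell_mass h K j.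
Proof.
  intros Hj. destruct (cell_interval K j Hj) as [H1 [H2 H3]]. apply weight_RInt_ge0; lra.
Qed.

Lemma half_node n j : (j <= n)%nat -> 0 < (INR j + 1 / 2) / INR (2 * n + 1) <= 1 / 2.
Proof.
  intros Hj. apply le_INR in Hj. rewrite INR_odd. generalize (pos_INR j). intros.
  split; [apply Rdiv_lt_0_compat; lra |]. apply Rle_div_l; lra.
Qed.

Lemma half_mass_ge0 n j : (j <= n)%nat -> 0 <= half_mass h n j.
Proof. intros Hj. generalize (half_node n j Hj). intros. apply weight_RInt_ge0; lra. Qed.

Lemma half_mass_step n j : (j < n)%nat ->
  half_mass h n j = cell_mass h (2 * n + 1) (S j) + half_mass h n (S j).
Proof.
  intros Hj. unfold half_mass, cell_mass.
  replace (INR (S j) - 1 / 2) with (INR j + 1 / 2) by (rewrite S_INR; field).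
  generalize (half_node n j ltac:(lia)) (half_node n (S j) ltac:(lia)). intros.
  symmetry. apply weight_Chasles; lra.
Qed.

Lemma cell_mass_reflect K j : (0 < j < K)%nat ->
  cell_mass (fun t => h (1 - t)) K j = cell_mass h K (K - j).
Proof.
  intros Hj. destruct (cell_interval K (K - j) ltac:(lia)) as [H1 [H2 _]].
  unfold cell_mass in *. rewrite <- (RInt_reflect h) by (apply weight_ex_RInt; lra).
  assert (0 < INR K) by (apply lt_0_INR; lia).
  rewrite minus_INR by lia. f_equal; field; lra.
Qed.

Context (psi pinv : R -> R).
Context (psi_incr : forall x y, 0 <= x -> x < y -> psi x < psi y).
Context (pinv_spec : forall y, 0 <= y -> 0 <= pinv y /\ psi (pinv y) = y).

Lemma pinv_mono x y : 0 <= x <= y -> pinv x <= pinv y.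
Proof.
  intros H. apply Rnot_lt_le. intros Hlt.
  destruct (pinv_spec x ltac:(lra)) as [_ H1], (pinv_spec y ltac:(lra)) as [H2 H3].
  generalize (psi_incr _ _ H2 Hlt). lra.
Qed.

(** [pinv] is specified on nonnegative arguments only; cutting at 0 makes it continuous on the whole
    line, so that its composites can be integrated. *)
Lemma pinv_max_continuous : 0 <= psi 0 -> forall y, continuity_pt (fun x => pinv (Rmax 0 x)) y.
Proof.
  intros H0 y e He. set (y0 := Rmax 0 y). assert (Hy0 : 0 <= y0) by apply Rmax_l.
  destruct (pinv_spec y0 Hy0) as [Hp0 Hp]. set (p := pinv y0) in *.
  assert (Hup : psi p < psi (p + e)) by (apply psi_incr; lra).
  (* Monotonicity of [psi] is known on nonnegative arguments only; when [p - e] is negative the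
     lower bound follows from the sign of [pinv z]. *)
  assert (Hlo : exists d, 0 < d /\ forall z, 0 <= z -> y0 - d < z -> p - e < pinv z).
  { destruct (Rle_lt_dec e p) as [Hle | Hlt].
    - assert (Hl : psi (p - e) < psi p) by (apply psi_incr; lra).
      exists (psi p - psi (p - e)). split; [lra |]. intros z Hz Hzd.
      apply Rnot_le_lt. intros Hc.
      destruct (pinv_spec z Hz) as [Ha Hb].
      destruct Hc as [Hc | Hc]; [generalize (psi_incr _ _ Ha Hc); lra | rewrite Hc in Hb; lra].
    - exists 1. split; [lra |]. intros z Hz _. destruct (pinv_spec z Hz). lra. }
  destruct Hlo as [d [Hd Hlo]].
  exists (Rmin d (psi (p + e) - psi p)). split; [apply Rmin_glb_lt; lra |].
  intros x [_ Hx]. simpl in *. unfold R_dist in *. fold y0. fold p.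
  set (z := Rmax 0 x). assert (Hz : 0 <= z) by apply Rmax_l.
  assert (Hzy : Rabs (z - y0) <= Rabs (x - y)).
  { unfold z, y0, Rmax. destruct (Rle_dec 0 x), (Rle_dec 0 y); unfold Rabs;
      repeat destruct Rcase_abs; lra. }
  generalize (Rmin_l d (psi (p + e) - psi p)) (Rmin_r d (psi (p + e) - psi p)). intros.
  assert (Hzy' : Rabs (z - y0) < Rmin d (psi (p + e) - psi p)) by lra.
  apply Rabs_def2 in Hzy'.
  apply Rabs_def1; [| generalize (Hlo z Hz ltac:(lra)); lra].
  apply Rnot_le_lt. intros Hc. destruct (pinv_spec z Hz) as [Ha Hb].
  assert (Hc' : p + e <= pinv z) by lra.
  destruct Hc' as [Hc' | Hc'].
  - assert (psi (p + e) < psi (pinv z)) by (apply psi_incr; lra). lra.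
  - rewrite <- Hc' in Hb. lra.
Qed.

(** The integrand of the integrability condition at 0; it decreases on (0,1/2] and may be unbounded
    near 0. *)
Definition tail_profile (s : R) : R := pinv (RInt h s (1 / 2)).

Lemma tail_profile_ex_RInt : 0 <= psi 0 ->
  forall a b, 0 < a <= 1 / 2 -> 0 < b <= 1 / 2 -> ex_RInt tail_profile a b.
Proof.
  intros H0 a b Ha Hb.
  apply (ex_RInt_ext (fun s => pinv (Rmax 0 (RInt h s (1 / 2))))).
  { intros x Hx. unfold tail_profile. rewrite Rmax_right; [reflexivity |].
    revert Hx. unfold Rmin, Rmax. destruct (Rle_dec a b); intros; apply weight_RInt_ge0; lra. }
  apply (ex_RInt_continuous (V := R_CompleteNormedModule)). intros z Hz.
  assert (Hz' : 0 < z < 1) by (revert Hz; unfold Rmin, Rmax; destruct (Rle_dec a b); lra).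
  apply (continuous_comp (fun s => RInt h s (1 / 2)) (fun y => pinv (Rmax 0 y))).
  - apply (continuous_RInt_2 h z (1 / 2) (fun s => RInt h s (1 / 2))).
    assert (Hr : 0 < Rmin z (1 - z)) by (apply Rmin_glb_lt; lra).
    exists (mkposreal _ Hr). intros y Hy. apply (RInt_correct (V := R_CompleteNormedModule)).
    unfold ball in Hy; simpl in Hy. unfold AbsRing_ball, abs, minus, plus, opp in Hy; simpl in Hy.
    apply Rabs_def2 in Hy. generalize (Rmin_l z (1 - z)) (Rmin_r z (1 - z)). intros.
    apply weight_ex_RInt; lra.
  - apply continuity_pt_filterlim, pinv_max_continuous, H0.
Qed.

Lemma tail_profile_anti a b : 0 < a <= b -> b <= 1 / 2 -> tail_profile b <= tail_profile a.
Proof.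
  intros Ha Hb. apply pinv_mono. split; [apply weight_RInt_ge0; lra |].
  rewrite <- (weight_Chasles a b) by lra. generalize (weight_RInt_ge0 a b Ha ltac:(lra)). lra.
Qed.

Lemma tail_profile_ge0 a : 0 < a <= 1 / 2 -> 0 <= tail_profile a.
Proof. intros Ha. apply pinv_spec, weight_RInt_ge0; lra. Qed.

Lemma tail_profile_RInt_ge0 a b : 0 <= psi 0 -> 0 < a <= b -> b <= 1 / 2 ->
  0 <= RInt tail_profile a b.
Proof.
  intros H0 Ha Hb. apply RInt_ge_0; [lra | apply tail_profile_ex_RInt; lra |].
  intros x Hx. apply tail_profile_ge0. lra.
Qed.

Lemma tail_profile_Chasles a b c : 0 <= psi 0 ->
  0 < a <= 1 / 2 -> 0 < b <= 1 / 2 -> 0 < c <= 1 / 2 ->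
  RInt tail_profile a b + RInt tail_profile b c = RInt tail_profile a c.
Proof.
  intros H0 Ha Hb Hc. apply (RInt_Chasles tail_profile); apply tail_profile_ex_RInt; assumption.
Qed.

Lemma tail_profile_lower a b : 0 <= psi 0 -> 0 < a <= b -> b <= 1 / 2 ->
  (b - a) * tail_profile b <= RInt tail_profile a b.
Proof.
  intros H0 Ha Hb.
  apply Rle_trans with (RInt (fun _ => tail_profile b) a b).
  - rewrite (RInt_const (V := R_CompleteNormedModule)). apply Rle_refl.
  - apply RInt_le; [lra | apply ex_RInt_const | apply tail_profile_ex_RInt; lra |].
    intros x Hx. apply tail_profile_anti; lra.
Qed.

(** * Midpoint sums of the tail profile and their uniform integrability *)

Definition half_sum (n m : nat) : R :=
  rsum (fun j => / INR (2 * n + 1) * pinv (half_mass h n j)) m.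

(** Each term is compared with the integral of the decreasing profile over an interval ending at its
    sample point. From node [j] to the sample point the length is half a cell, which costs a factor
    2; for [j = 0] the interval starts at a quarter of a cell, to stay away from 0, which costs the
    factor 4. *)
Lemma half_sum_le_RInt n m : 0 <= psi 0 -> (0 < m <= n)%nat ->
  half_sum n m <=
  4 * RInt tail_profile (/ (4 * INR (2 * n + 1))) (INR m / INR (2 * n + 1)).
Proof.
  intros H0 [Hm Hmn].
  set (K := INR (2 * n + 1)).
  assert (HK : K = 2 * INR n + 1) by apply INR_odd.
  assert (Hn1 : 1 <= INR n) by (change 1 with (INR 1); apply le_INR; lia).
  assert (HKi : 0 < / K) by (apply Rinv_0_lt_compat; lra).
  assert (Hnode : forall x, 0 <= x <= INR n -> 0 <= x / K <= 1 / 2).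
  { intros x Hx. split; [apply Rdiv_le_0_compat; lra | apply Rle_div_l; lra]. }
  assert (Hq : / (4 * K) = (1 / 4) / K) by (field; lra).
  assert (Hlt : forall x y, x < y -> x / K < y / K) by (intros; apply Rmult_lt_compat_r; auto).
  assert (Hval : forall j, / K * pinv (half_mass h n j) = / K * tail_profile ((INR j + 1 / 2) / K)) by reflexivity.
  unfold half_sum. fold K. induction Hm as [|m Hm IH]; simpl rsum; fold K.
  - rewrite Hval, Hq. simpl INR.
    replace (0 + 1 / 2) with (1 / 2) by lra.
    generalize (Hlt (1 / 4) (1 / 2) ltac:(lra)) (Hlt (1 / 2) 1 ltac:(lra)) (Hnode 1 ltac:(lra)).
    assert (Hz : 0 < (1 / 4) / K) by (apply Rdiv_lt_0_compat; lra). intros.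
    rewrite <- (tail_profile_Chasles _ (1 / 2 / K)) by (simpl INR; lra).
    generalize (tail_profile_lower (1 / 4 / K) (1 / 2 / K) H0 ltac:(lra) ltac:(lra)).
    generalize (tail_profile_RInt_ge0 (1 / 2 / K) (1 / K) H0 ltac:(lra) ltac:(lra)).
    replace (1 / 2 / K - 1 / 4 / K) with (/ K * / 4) by (field; lra). lra.
  - specialize (IH ltac:(lia)). rewrite Hval.
    assert (Hm0 : 1 <= INR m) by (change 1 with (INR 1); apply le_INR; lia).
    assert (Hmn' : INR m + 1 <= INR n) by (rewrite <- S_INR; apply le_INR; lia).
    assert (Hmm : INR (S m) = INR m + 1) by apply S_INR. rewrite Hmm.
    assert (Hz : 0 < (1 / 4) / K) by (apply Rdiv_lt_0_compat; lra).
    generalize (Hlt (INR m) (INR m + 1 / 2) ltac:(lra)) (Hlt (INR m + 1 / 2) (INR m + 1) ltac:(lra))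
      (Hlt (1 / 4) (INR m) ltac:(lra)) (Hnode (INR m + 1) ltac:(lra)). rewrite Hq in *. intros.
    rewrite <- (tail_profile_Chasles _ (INR m / K)) by lra.
    rewrite <- (tail_profile_Chasles (INR m / K) ((INR m + 1 / 2) / K)) by lra.
    generalize (tail_profile_lower (INR m / K) ((INR m + 1 / 2) / K) H0 ltac:(lra) ltac:(lra)).
    generalize (tail_profile_RInt_ge0 ((INR m + 1 / 2) / K) ((INR m + 1) / K) H0 ltac:(lra) ltac:(lra)).
    replace ((INR m + 1 / 2) / K - INR m / K) with (/ K * / 2) by (field; lra).
    generalize (Rmult_le_pos _ _ (Rlt_le _ _ HKi) (tail_profile_ge0 ((INR m + 1 / 2) / K) ltac:(lra))). lra.
Qed.

(** Uniform integrability in [n]: the first clause feeds the bound on the maximum, the second makes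
    the limit function vanish at the end of the interval. *)
Definition half_sums_controlled : Prop :=
  (exists M, 0 < M /\ forall n m, (m <= n)%nat -> half_sum n m <= M) /\
  (forall e, 0 < e -> exists t, 0 < t /\
     forall n m, (m <= n)%nat -> INR m / INR (2 * n + 1) <= t -> half_sum n m <= e).

Lemma half_sums_controlled_of_RInt : 0 <= psi 0 ->
  (exists M, forall e, 0 < e <= 1 / 2 -> RInt tail_profile e (1 / 2) <= M) ->
  half_sums_controlled.
Proof.
  intros H0 [M HM].
  assert (HM0 : 0 <= M).
  { generalize (HM (1 / 2) ltac:(lra)). generalize (tail_profile_RInt_ge0 (1 / 2) (1 / 2) H0 ltac:(lra) ltac:(lra)). lra. }
  assert (Hgrid : forall n m, (0 < m <= n)%nat ->
     0 < / (4 * INR (2 * n + 1)) < INR m / INR (2 * n + 1) /\ INR m / INR (2 * n + 1) <= 1 / 2).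
  { intros n m [Hm Hmn]. apply le_INR in Hmn.
    assert (1 <= INR m) by (change 1 with (INR 1); apply le_INR; lia).
    rewrite INR_odd. repeat split.
    - apply Rinv_0_lt_compat. lra.
    - replace (/ (4 * (2 * INR n + 1))) with ((1 / 4) / (2 * INR n + 1)) by (field; lra).
      apply Rmult_lt_compat_r; [apply Rinv_0_lt_compat |]; lra.
    - apply Rle_div_l; lra. }
  split.
  - exists (4 * M + 1). split; [lra |]. intros n m Hm.
    destruct (Nat.eq_dec m 0) as [-> | Hm0]; [unfold half_sum; simpl; lra |].
    apply Rle_trans with (1 := half_sum_le_RInt n m H0 ltac:(lia)).
    destruct (Hgrid n m ltac:(lia)) as [H1 H2].
    generalize (HM (/ (4 * INR (2 * n + 1))) ltac:(lra)).
    generalize (tail_profile_RInt_ge0 (INR m / INR (2 * n + 1)) (1 / 2) H0 ltac:(lra) ltac:(lra)).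
    rewrite <- (tail_profile_Chasles (/ (4 * INR (2 * n + 1))) (INR m / INR (2 * n + 1)) (1 / 2)) by lra.
    lra.
  - intros e He.
    (* [L] is the improper integral. Less than [e / 4] of it remains between 0 and the chosen [t],
       and the factor 4 of [half_sum_le_RInt] turns this into [e]. *)
    destruct (completeness (fun y => exists s, 0 < s <= 1 / 2 /\ y = RInt tail_profile s (1 / 2)))
      as [L [Hub Hlub]].
    + exists M. intros y [s [Hs ->]]. auto.
    + exists (RInt tail_profile (1 / 2) (1 / 2)), (1 / 2). split; [lra | reflexivity].
    + assert (Hex : exists s, 0 < s <= 1 / 2 /\ L - e / 4 < RInt tail_profile s (1 / 2)).
      { apply NNPP. intros Hn. assert (L <= L - e / 4); [| lra].
        apply Hlub. intros y [s [Hs ->]]. apply Rnot_lt_le. intros Hlt. apply Hn. exists s. auto. }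
      destruct Hex as [t [Ht HtL]]. exists t. split; [lra |]. intros n m Hm Hmt.
      destruct (Nat.eq_dec m 0) as [-> | Hm0]; [unfold half_sum; simpl; lra |].
      apply Rle_trans with (1 := half_sum_le_RInt n m H0 ltac:(lia)).
      destruct (Hgrid n m ltac:(lia)) as [H1 H2].
      generalize (tail_profile_RInt_ge0 (INR m / INR (2 * n + 1)) t H0 ltac:(lra) ltac:(lra)).
      assert (HL : RInt tail_profile (/ (4 * INR (2 * n + 1))) (1 / 2) <= L).
      { apply Hub. exists (/ (4 * INR (2 * n + 1))). split; [lra | reflexivity]. }
      rewrite <- (tail_profile_Chasles (/ (4 * INR (2 * n + 1))) t (1 / 2)) in HL by lra.
      rewrite <- (tail_profile_Chasles (/ (4 * INR (2 * n + 1))) (INR m / INR (2 * n + 1)) t) in HL by lra.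
      lra.
Qed.

End Weight.

Lemma half_sums_controlled_left (h psi pinv : R -> R) :
  (forall t, 0 < t < 1 -> continuity_pt h t) -> (forall t, 0 < t < 1 -> 0 <= h t) ->
  0 <= psi 0 -> (forall x y, 0 <= x -> x < y -> psi x < psi y) ->
  (forall y, 0 <= y -> 0 <= pinv y /\ psi (pinv y) = y) ->
  impr_int_finite_left (fun s => pinv (Rint h s (1 / 2))) 0 (1 / 2) ->
  half_sums_controlled h pinv.
Proof.
  intros Hc Hp H0 Hi Hinv [M HM].
  apply (half_sums_controlled_of_RInt h Hc Hp psi pinv Hi Hinv H0).
  exists M. intros e He. apply Rle_trans with (2 := HM e He). right.
  assert (Hext : forall x, Rmin e (1 / 2) < x < Rmax e (1 / 2) ->
    tail_profile h pinv x = pinv (Rint h x (1 / 2))).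
  { intros x Hx. rewrite Rmin_left, Rmax_right in Hx by lra.
    unfold tail_profile. rewrite Rint_RInt; [reflexivity | apply weight_ex_RInt; auto; lra]. }
  (* [Rint] is 0 on functions that are not Riemann integrable, so integrability has to be shown
     before the hypothesis bounds a true integral. *)
  rewrite Rint_RInt; [apply RInt_ext, Hext |].
  apply (ex_RInt_ext (tail_profile h pinv)); [exact Hext |].
  apply (tail_profile_ex_RInt h Hc Hp psi pinv Hi Hinv H0); lra.
Qed.

(** Reflection about 1/2 turns the condition at 1 into the condition at 0 for the reflected
    weight. *)
Lemma half_sums_controlled_right (h psi pinv : R -> R) :
  (forall t, 0 < t < 1 -> continuity_pt h t) -> (forall t, 0 < t < 1 -> 0 <= h t) ->
  0 <= psi 0 -> (forall x y, 0 <= x -> x < y -> psi x < psi y) ->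
  (forall y, 0 <= y -> 0 <= pinv y /\ psi (pinv y) = y) ->
  impr_int_finite_right (fun s => pinv (Rint h (1 / 2) s)) (1 / 2) 1 ->
  half_sums_controlled (fun t => h (1 - t)) pinv.
Proof.
  intros Hc Hp H0 Hi Hinv [M HM].
  assert (Hc' : forall t, 0 < t < 1 -> continuity_pt (fun t => h (1 - t)) t).
  { intros t Ht. apply (continuity_pt_comp (fun t => 1 - t) h); [reg | apply Hc; lra]. }
  assert (Hp' : forall t, 0 < t < 1 -> 0 <= h (1 - t)) by (intros; apply Hp; lra).
  apply (half_sums_controlled_of_RInt _ Hc' Hp' psi pinv Hi Hinv H0).
  exists M. intros e He. apply Rle_trans with (2 := HM (1 - e) ltac:(lra)). right.
  assert (Hex : ex_RInt (tail_profile (fun t => h (1 - t)) pinv) e (1 / 2))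
    by (apply (tail_profile_ex_RInt _ Hc' Hp' psi pinv Hi Hinv H0); lra).
  assert (Hext : forall x, Rmin (1 / 2) (1 - e) < x < Rmax (1 / 2) (1 - e) ->
    tail_profile (fun t => h (1 - t)) pinv (1 - x) = pinv (Rint h (1 / 2) x)).
  { intros x Hx. rewrite Rmin_left, Rmax_right in Hx by lra.
    unfold tail_profile.
    assert (Hexh : ex_RInt h (1 / 2) x) by (apply weight_ex_RInt; auto; lra).
    rewrite Rint_RInt by exact Hexh. f_equal.
    rewrite <- (RInt_reflect h (1 / 2) x Hexh). f_equal. lra. }
  assert (Hr := is_RInt_reflect _ _ _ _ (RInt_correct (V := R_CompleteNormedModule) _ _ _ Hex)).
  replace (1 - 1 / 2) with (1 / 2) in Hr by lra.
  apply (is_RInt_ext _ _ _ _ _ Hext) in Hr.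
  rewrite Rint_RInt; [symmetry; apply is_RInt_unique, Hr | eexists; exact Hr].
Qed.

(** * Shooting and the passage to the limit *)

Fixpoint prefix_max (u : nat -> R) (m : nat) : R :=
  match m with O => u O | S k => Rmax (prefix_max u k) (u (S k)) end.

Lemma prefix_max_ge u m j : (j <= m)%nat -> u j <= prefix_max u m.
Proof.
  induction m as [|m IH]; intros Hj; simpl.
  - replace j with O by lia. lra.
  - destruct (Nat.eq_dec j (S m)) as [-> | Hn]; [apply Rmax_r |].
    apply Rle_trans with (1 := IH ltac:(lia)), Rmax_l.
Qed.

Lemma prefix_max_attained u m : exists j, (j <= m)%nat /\ u j = prefix_max u m.
Proof.
  induction m as [|m [j [Hj IH]]]; simpl; [exists O; split; auto |].
  unfold Rmax. destruct (Rle_dec _ _); [exists (S m); auto | exists j; auto].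
Qed.

Lemma Rmax_half_abs x y : Rmax x y = (x + y + Rabs (x - y)) / 2.
Proof. unfold Rmax, Rabs. destruct (Rle_dec x y), (Rcase_abs (x - y)); lra. Qed.

Lemma continuity_Rmax (f g : R -> R) :
  continuity f -> continuity g -> continuity (fun x => Rmax (f x) (g x)).
Proof.
  intros Hf Hg x.
  apply (continuity_pt_ext (fun x => (f x + g x + Rabs (f x - g x)) * / 2)).
  { intros y. symmetry. apply Rmax_half_abs. }
  apply (continuity_pt_mult (fun x => f x + g x + Rabs (f x - g x)) (fun _ => / 2));
    [| apply continuity_pt_const; intros a b; reflexivity].
  apply (continuity_pt_plus (fun x => f x + g x)).
  - apply continuity_pt_plus; auto.
  - apply (continuity_pt_comp (fun x => f x - g x) Rabs).
    + apply continuity_pt_minus; auto.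
    + apply Rcontinuity_abs.
Qed.

Lemma continuity_Rmin (f g : R -> R) :
  continuity f -> continuity g -> continuity (fun x => Rmin (f x) (g x)).
Proof.
  intros Hf Hg x.
  apply (continuity_pt_ext (fun x => - Rmax (- f x) (- g x))).
  { intros y. unfold Rmax, Rmin. destruct (Rle_dec (f y) (g y)), (Rle_dec (- f y) (- g y)); lra. }
  apply continuity_pt_opp.
  apply (continuity_Rmax (fun x => - f x) (fun x => - g x)); intros y; apply continuity_pt_opp; auto.
Qed.

Lemma continuity_prefix_max (u : R -> nat -> R) m :
  (forall j, (j <= m)%nat -> continuity (fun s => u s j)) ->
  continuity (fun s => prefix_max (u s) m).
Proof.
  induction m as [|m IH]; intros H; simpl; [apply H; lia |].
  apply (continuity_Rmax (fun s => prefix_max (u s) m) (fun s => u s (S m)));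
    [apply IH; intros; apply H; lia | apply H; lia].
Qed.

(** The auxiliary function is negative where [m <= x] and positive where [m >= y]; it
    vanishes in between only at zeros of [F]. *)
Lemma ivt_band (m F : R -> R) (x y s1 : R) :
  continuity m -> continuity F -> x < y ->
  (forall s, 0 <= s -> m s = x -> F s < 0) -> (forall s, 0 <= s -> m s = y -> 0 < F s) ->
  m 0 < x -> 0 < s1 -> y < m s1 ->
  exists s, 0 <= s /\ F s = 0 /\ x <= m s <= y.
Proof.
  intros Hm HF Hxy Hx Hy H0 Hs1 H1.
  set (P := fun s => Rmax (m s - y) (Rmin (F s) (m s - x))).
  assert (HP : continuity P).
  { apply (continuity_Rmax (fun s => m s - y) (fun s => Rmin (F s) (m s - x))).
    - intros s. apply (continuity_pt_minus m (fun _ => y)); [apply Hm |].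
      apply continuity_pt_const. intros a b. reflexivity.
    - apply (continuity_Rmin F (fun s => m s - x)); [exact HF |]. intros s.
      apply (continuity_pt_minus m (fun _ => x)); [apply Hm |].
      apply continuity_pt_const. intros a b. reflexivity. }
  destruct (IVT_cor P 0 s1 HP ltac:(lra)) as [s [Hs HPs]].
  { assert (P 0 <= 0) by (apply Rmax_lub; [| apply Rle_trans with (1 := Rmin_r _ _)]; lra).
    assert (0 <= P s1) by (apply Rle_trans with (2 := Rmax_l _ _); lra). nra. }
  exists s. split; [lra |].
  generalize (Hx s ltac:(lra)) (Hy s ltac:(lra)). revert HPs. unfold P, Rmax, Rmin.
  destruct (Rle_dec (F s) (m s - x)).
  - destruct (Rle_dec (m s - y) (F s)); intros Hz Hx' Hy'.
    + repeat split; lra.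
    + generalize (Hy' ltac:(lra)). lra.
  - destruct (Rle_dec (m s - y) (m s - x)); intros Hz Hx' Hy'.
    + generalize (Hx' ltac:(lra)). lra.
    + lra.
Qed.

Section Shooting.

Context (gl gu : R -> R) (K0 : R).
Context (gl_mono : forall x y, 0 <= x <= y -> gl x <= gl y).
Context (gu_mono : forall x y, 0 <= x <= y -> gu x <= gu y).
Context (gl_pos : forall x, 0 < x -> 0 < gl x).
Context (gl_0 : gl 0 = 0) (gu_0 : gu 0 = 0).
Context (K0_ge0 : 0 <= K0).
Context (gu_gl : forall x, 0 <= x -> gu x <= K0 * gl x).
Context (gl_large : forall y, exists x, 0 < x /\ y < gl x).
Context (h : R -> R) (h_cont : forall t, 0 < t < 1 -> continuity_pt h t).
Context (h_ge0 : forall t, 0 < t < 1 -> 0 <= h t).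

Lemma gl_ge0 x : 0 <= x -> 0 <= gl x.
Proof. intros Hx. rewrite <- gl_0. apply gl_mono. lra. Qed.

Lemma gu_ge0 x : 0 <= x -> 0 <= gu x.
Proof. intros Hx. rewrite <- gu_0. apply gu_mono. lra. Qed.

(** * The bound on the maximum in terms of the tail masses *)

Section Upper.

Context (w : R -> R) (w_cont : forall t, 0 < t < 1 -> continuity_pt w t).
Context (w_ge0 : forall t, 0 < t < 1 -> 0 <= w t).
Context (pinv : R -> R) (pinv_ge0 : forall y, 0 <= y -> 0 <= pinv y).
Context (k Ck : R) (k_ge0 : 0 <= k) (Ck_ge0 : 0 <= Ck).
Context (gu_split : forall B y, 0 <= B -> 0 <= y -> gu (B + k * y) <= gu (2 * B) + Ck * pinv y).

(** Going left from cell [sig], the flux gains at most [k] times the masses passed, so it is at most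
    [B + k * half_mass w n j] on cell [j]. [gu_split] separates the summands: the first contributes
    linearly in [m], the second as a midpoint sum. *)
Lemma chain_left_estimate n u v B sig m :
  chain gl gu (2 * n + 1) (/ INR (2 * n + 1)) u v ->
  (forall j, (S j < 2 * n + 1)%nat -> v j - v (S j) <= k * cell_mass w (2 * n + 1) (S j)) ->
  0 <= B -> v sig <= B -> (m <= sig <= n)%nat ->
  u m - u O <= INR m / INR (2 * n + 1) * gu (2 * B) + Ck * half_sum w pinv n m.
Proof.
  intros C Hstep HB Hv [Hm Hsig].
  assert (HK : 0 <= / INR (2 * n + 1)).
  { apply Rlt_le, Rinv_0_lt_compat, lt_0_INR. lia. }
  (* Induction backwards from [sig]; the tail masses reach up to 1/2 and therefore dominate the
     masses up to [sig]. *)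
  assert (Hv' : forall i, (i <= sig)%nat -> v (sig - i)%nat <= B + k * half_mass w n (sig - i)).
  { induction i as [|i IH]; intros Hi.
    - rewrite Nat.sub_0_r. generalize (half_mass_ge0 w w_cont w_ge0 n sig Hsig). nra.
    - specialize (IH ltac:(lia)).
      generalize (Hstep (sig - S i)%nat ltac:(lia)).
      rewrite (half_mass_step w w_cont n (sig - S i)) by lia.
      replace (S (sig - S i)) with (sig - i)%nat by lia. lra. }
  assert (Hj : forall j, (j < m)%nat -> v j <= B + k * half_mass w n j /\ 0 <= half_mass w n j).
  { intros j Hj. split; [| apply (half_mass_ge0 w w_cont w_ge0); lia].
    replace j with (sig - (sig - j))%nat by lia. apply Hv'. lia. }
  apply Rle_trans with
    (rsum (fun j => / INR (2 * n + 1) * (gu (2 * B) + Ck * pinv (half_mass w n j))) m).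
  - apply (chain_upper gl gu gl_ge0 (2 * n + 1) _ HK u v _ m C); [lia | |].
    + intros j Hjm Hvj. destruct (Hj j Hjm) as [H1 H2].
      apply Rle_trans with (2 := gu_split B _ HB H2). apply gu_mono. lra.
    + intros j Hjm. destruct (Hj j Hjm) as [H1 H2].
      apply Rplus_le_le_0_compat; [apply gu_ge0; lra | apply Rmult_le_pos; auto].
  - right. apply rsum_affine.
Qed.

(** At a peak the flux on the next cell is not positive, so [chain_left_estimate] applies with
    [B = 0] and its linear term disappears. *)
Lemma chain_peak_left n u v sig M :
  chain gl gu (2 * n + 1) (/ INR (2 * n + 1)) u v ->
  (forall j, (S j < 2 * n + 1)%nat -> v j - v (S j) <= k * cell_mass w (2 * n + 1) (S j)) ->
  (sig <= n)%nat -> u (S sig) <= u sig -> half_sum w pinv n sig <= M ->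
  u sig - u O <= Ck * M.
Proof.
  intros C Hstep Hsig Hu HM.
  assert (HK : 0 < / INR (2 * n + 1)) by (apply Rinv_0_lt_compat, lt_0_INR; lia).
  assert (Hv : v sig <= 0).
  { apply Rnot_lt_le. intros Hlt.
    destruct (chain_up _ _ _ _ _ _ C sig ltac:(lia) ltac:(lra)) as [H _].
    generalize (Rmult_lt_0_compat _ _ HK (gl_pos _ Hlt)). lra. }
  generalize (chain_left_estimate n u v 0 sig sig C Hstep ltac:(lra) Hv ltac:(lia)).
  rewrite Rmult_0_r, gu_0, Rmult_0_r. generalize (Rmult_le_compat_l _ _ _ Ck_ge0 HM). lra.
Qed.

End Upper.

Lemma chain_rev_step w k K v : (forall t, 0 < t < 1 -> continuity_pt w t) ->
  (forall j, (S j < K)%nat -> v j - v (S j) <= k * cell_mass w K (S j)) ->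
  forall j, (S j < K)%nat ->
  - v (K - 1 - j)%nat - - v (K - 1 - S j)%nat <= k * cell_mass (fun t => w (1 - t)) K (S j).
Proof.
  intros Hw H j Hj. rewrite cell_mass_reflect by (auto; lia).
  generalize (H (K - 1 - S j)%nat ltac:(lia)).
  replace (S (K - 1 - S j)) with (K - 1 - j)%nat by lia.
  replace (K - S j)%nat with (K - 1 - j)%nat by lia. lra.
Qed.

Lemma reflect_cont : forall t, 0 < t < 1 -> continuity_pt (fun t => h (1 - t)) t.
Proof.
  intros t Ht. apply (continuity_pt_comp (fun t => 1 - t) h); [reg | apply h_cont; lra].
Qed.

Lemma reflect_ge0 : forall t, 0 < t < 1 -> 0 <= h (1 - t).
Proof. intros t Ht. apply h_ge0. lra. Qed.

(** The peak lies in one of the two halves. A peak in the right half is treated on the reversed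
    grid, where [u (2 * n + 1) <= 0] takes over the role of [u O = 0]. *)
Lemma chain_peak n u v k Ck pinv M :
  (forall y, 0 <= y -> 0 <= pinv y) -> 0 <= k -> 0 <= Ck ->
  (forall B y, 0 <= B -> 0 <= y -> gu (B + k * y) <= gu (2 * B) + Ck * pinv y) ->
  (forall m, (m <= n)%nat -> half_sum h pinv n m <= M) ->
  (forall m, (m <= n)%nat -> half_sum (fun t => h (1 - t)) pinv n m <= M) ->
  chain gl gu (2 * n + 1) (/ INR (2 * n + 1)) u v ->
  (forall j, (S j < 2 * n + 1)%nat -> v j - v (S j) <= k * cell_mass h (2 * n + 1) (S j)) ->
  u O = 0 -> u (2 * n + 1)%nat <= 0 ->
  prefix_max u (2 * n + 1) <= Ck * M.
Proof.
  intros Hpi Hk HCk Hsplit HM HM' C Hstep H0 HK.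
  destruct (prefix_max_attained u (2 * n + 1)) as [sig [Hsig Heq]]. rewrite <- Heq.
  assert (Hge : forall j, (j <= 2 * n + 1)%nat -> u j <= u sig)
    by (intros j Hj; rewrite Heq; apply prefix_max_ge, Hj).
  destruct (Nat.le_gt_cases sig n) as [Hn | Hn].
  - generalize (chain_peak_left h h_cont h_ge0 pinv Hpi k Ck Hk HCk Hsplit n u v sig M C Hstep Hn
      (Hge (S sig) ltac:(lia)) (HM sig Hn)). lra.
  - generalize (chain_peak_left _ reflect_cont reflect_ge0 pinv Hpi k Ck Hk HCk Hsplit n _ _
      (2 * n + 1 - sig)%nat M (chain_rev _ _ _ _ _ _ C)
      (chain_rev_step h k _ v h_cont Hstep) ltac:(lia)).
    cbv beta. rewrite Nat.sub_0_r.
    replace (2 * n + 1 - (2 * n + 1 - sig))%nat with sig by lia.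
    intros H. specialize (H (Hge (2 * n + 1 - S (2 * n + 1 - sig))%nat ltac:(lia))
      (HM' (2 * n + 1 - sig)%nat ltac:(lia))). lra.
Qed.

(** * The discrete shooting map *)

Context (g : R -> R -> R) (F : R -> R) (lam : R).
Context (g_bound : forall t x, 0 < t < 1 -> 0 <= x -> gl x <= g t x <= gu x).
Context (g_odd : forall t x, g t (- x) = - g t x).
Context (g_cont : forall t, 0 < t < 1 -> continuity (g t)).
Context (F_cont : continuity F) (F_ge0 : forall x, 0 <= F x) (lam_pos : 0 < lam).

(** A staggered scheme: the flux of cell [i] drives [u] across that cell, with [g] taken at the cell
    midpoint, and the new height then updates the flux. Nothing is solved implicitly, so every entry
    is an explicit composite of continuous functions of [s]. *)
Fixpoint shoot (K : nat) (s : R) (j : nat) : R * R :=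
  match j with
  | O => (0, s)
  | S i =>
      let p := shoot K s i in
      let u' := fst p + / INR K * g ((INR i + 1 / 2) / INR K) (snd p) in
      (u', snd p - lam * F u' * cell_mass h K (S i))
  end.

Definition su K s j := fst (shoot K s j).
Definition sv K s j := snd (shoot K s j).

Lemma su_S K s j : su K s (S j) = su K s j + / INR K * g ((INR j + 1 / 2) / INR K) (sv K s j).
Proof. reflexivity. Qed.

Lemma sv_S K s j : sv K s (S j) = sv K s j - lam * F (su K s (S j)) * cell_mass h K (S j).
Proof. reflexivity. Qed.

Lemma mid_node K j : (j < K)%nat -> 0 < (INR j + 1 / 2) / INR K < 1.
Proof.
  intros H. apply le_INR in H. rewrite S_INR in H. generalize (pos_INR j). intros.
  split; [apply Rdiv_lt_0_compat; lra | apply Rlt_div_l; lra].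
Qed.

Lemma shoot_chain K s : chain gl gu K (/ INR K) (su K s) (sv K s).
Proof.
  split.
  - intros j Hj Hv. rewrite su_S.
    assert (HK : 0 < / INR K) by (apply Rinv_0_lt_compat, lt_0_INR; lia).
    destruct (g_bound _ _ (mid_node K j Hj) Hv). nra.
  - intros j Hj Hv. rewrite su_S.
    assert (HK : 0 < / INR K) by (apply Rinv_0_lt_compat, lt_0_INR; lia).
    rewrite <- (Ropp_involutive (sv K s j)), g_odd, Ropp_involutive.
    destruct (g_bound _ (- sv K s j) (mid_node K j Hj) ltac:(lra)). nra.
  - intros j Hj. rewrite sv_S.
    generalize (cell_mass_ge0 h h_cont h_ge0 K (S j) ltac:(lia)) (F_ge0 (su K s (S j))). intros.
    generalize (Rmult_le_pos _ _ (Rmult_le_pos _ _ (Rlt_le _ _ lam_pos) H0) H). lra.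
Qed.

Lemma shoot_continuity K j : (j <= K)%nat ->
  continuity (fun s => su K s j) /\ continuity (fun s => sv K s j).
Proof.
  induction j as [|j IH]; intros Hj.
  - split; intros s; unfold su, sv; simpl; reg.
  - destruct (IH ltac:(lia)) as [Hu Hv].
    assert (Hu' : continuity (fun s => su K s (S j))).
    { intros s. apply (continuity_pt_ext
        (fun s => su K s j + / INR K * g ((INR j + 1 / 2) / INR K) (sv K s j))).
      { intros y. symmetry. apply su_S. }
      apply (continuity_pt_plus (fun s => su K s j)); [apply Hu |].
      apply (continuity_pt_scal (fun s => g ((INR j + 1 / 2) / INR K) (sv K s j))).
      apply (continuity_pt_comp (fun s => sv K s j)); [apply Hv |].
      apply g_cont, mid_node. lia. }
    split; [exact Hu' |]. intros s.
    apply (continuity_pt_ext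
      (fun s => sv K s j - lam * cell_mass h K (S j) * F (su K s (S j)))).
    { intros y. rewrite (sv_S K y j). ring. }
    apply (continuity_pt_minus (fun s => sv K s j)); [apply Hv |].
    apply (continuity_pt_scal (fun s => F (su K s (S j)))).
    apply (continuity_pt_comp (fun s => su K s (S j))); [apply Hu' | apply F_cont].
Qed.

Definition smax K s := prefix_max (su K s) K.

Lemma smax_continuity K : continuity (smax K).
Proof. apply continuity_prefix_max. intros j Hj. apply shoot_continuity, Hj. Qed.

(** Started with zero flux, all fluxes are nonpositive and [u] never rises above its initial
    value. *)
Lemma smax_0 K : smax K 0 = 0.
Proof.
  apply Rle_antisym; [| apply (prefix_max_ge (su K 0) K 0); lia].
  destruct (prefix_max_attained (su K 0) K) as [j [Hj Heq]]. unfold smax. rewrite <- Heq.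
  assert (C := shoot_chain K 0).
  assert (HK : 0 <= / INR K).
  (* For [K = 0] the mesh width is the inverse of 0, which is 0 by convention. *)
  { destruct K; [simpl; rewrite Rinv_0; lra |]. apply Rlt_le, Rinv_0_lt_compat, lt_0_INR. lia. }
  assert (H : su K 0 j - su K 0 0 <= (INR j - INR 0) * 0).
  { apply telescope_le; [lia |]. intros i Hi.
    assert (Hv : sv K 0 i <= 0) by (apply (chain_anti _ _ _ _ _ _ C 0%nat i); lia).
    destruct (chain_down _ _ _ _ _ _ C i ltac:(lia) Hv) as [H' _].
    generalize (Rmult_le_pos _ _ HK (gl_ge0 (- sv K 0 i) ltac:(lra))). lra. }
  unfold su at 2 in H. simpl in H. lra.
Qed.

(** The first cell alone lifts [u] by at least [/ INR K * gl s]. *)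
Lemma smax_large K R0 : (0 < K)%nat -> exists s, 0 < s /\ R0 < smax K s.
Proof.
  intros HK. assert (HK' : 0 < INR K) by (apply lt_0_INR; lia).
  destruct (gl_large (R0 * INR K)) as [s [Hs Hlt]]. exists s. split; [exact Hs |].
  apply Rlt_le_trans with (2 := prefix_max_ge (su K s) K 1 ltac:(lia)).
  destruct (chain_up _ _ _ _ _ _ (shoot_chain K s) 0%nat HK ltac:(unfold sv; simpl; lra)) as [H _].
  unfold su at 2 in H. unfold sv in H. simpl in H.
  apply Rlt_le_trans with (/ INR K * gl s); [| lra].
  rewrite Rmult_comm. apply Rlt_div_r; lra.
Qed.

(** [F] is bounded on all of [x <= Mf] because a trajectory that ends at or below 0 may take
    negative values. *)
Lemma shoot_peak n s Mf B Ck pinv M :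
  (forall y, 0 <= y -> 0 <= pinv y) -> 0 <= B -> 0 <= Ck ->
  (forall x, x <= Mf -> F x <= B) ->
  (forall A y, 0 <= A -> 0 <= y -> gu (A + lam * B * y) <= gu (2 * A) + Ck * pinv y) ->
  (forall m, (m <= n)%nat -> half_sum h pinv n m <= M) ->
  (forall m, (m <= n)%nat -> half_sum (fun t => h (1 - t)) pinv n m <= M) ->
  su (2 * n + 1) s (2 * n + 1) <= 0 -> smax (2 * n + 1) s <= Mf ->
  smax (2 * n + 1) s <= Ck * M.
Proof.
  intros Hpi HB HCk HF Hsplit HM HM' Hend Hmax.
  apply (chain_peak n _ (sv (2 * n + 1) s) (lam * B) Ck pinv M); auto.
  - apply Rmult_le_pos; lra.
  - apply shoot_chain.
  - intros j Hj. rewrite sv_S.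
    assert (HFj : F (su (2 * n + 1) s (S j)) <= B).
    { apply HF. apply Rle_trans with (2 := Hmax). apply prefix_max_ge. lia. }
    generalize (cell_mass_ge0 h h_cont h_ge0 (2 * n + 1) (S j) ltac:(lia)). intros Hc.
    generalize (Rmult_le_compat_r _ _ _ (Rmult_le_pos _ _ (Rlt_le _ _ lam_pos) Hc) HFj). lra.
Qed.

(** If the end were nonnegative, so would be the whole trajectory, and the Harnack inequality would
    keep it above [rho / (1 + K0 / a0)] on [a,b]. There [F] is at least [Y] and [h] at least [h0],
    so the flux drops so much across [a,b] that [u] must exceed its own maximum [rho]. The 4 is a 2
    for grid losses at the ends of [a,b] times the 2 of [chain_flux_drop]. *)
Lemma shoot_overshoot K s a b a0 h0 rho Y : 0 < a0 -> a0 <= a -> a0 <= 1 - b -> a < b ->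
  (forall t, a <= t <= b -> h0 <= h t) -> 0 <= h0 -> 0 <= Y ->
  6 <= (b - a) * INR K ->
  (forall x, rho / (1 + K0 / a0) <= x <= rho -> Y <= F x) ->
  rho < a0 * gl ((b - a) * (lam * Y * h0) / 4) ->
  smax K s = rho -> su K s K < 0.
Proof.
  intros Ha0 Haa Hab Hlt Hh Hh0 HY HK HF Hrho Hmax. apply Rnot_le_lt. intros Hend.
  assert (HKpos : 0 < INR K) by nra.
  assert (HdK : 0 < / INR K) by (apply Rinv_0_lt_compat, HKpos).
  assert (C := shoot_chain K s).
  assert (Hge : forall j, (j <= K)%nat -> 0 <= su K s j).
  { intros j Hj. apply (chain_ge0 gl gu gl_mono gl_ge0 K (/ INR K) (Rlt_le _ _ HdK) _ (sv K s)); auto.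
    unfold su; simpl; lra. }
  assert (HK0a : 0 < 1 + K0 / a0) by (generalize (Rdiv_le_0_compat _ _ K0_ge0 Ha0); lra).
  destruct (nfloor_ex (a * INR K) ltac:(apply Rmult_le_pos; lra)) as [p0 Hp0].
  destruct (nfloor_ex (b * INR K) ltac:(apply Rmult_le_pos; lra)) as [q0 Hq0].
  assert (Hpq : INR p0 + 5 < INR q0 + 1) by lra.
  assert (Hq1 : INR q0 < INR K) by nra.
  assert (Hpq' : (p0 + 3 < q0)%nat).
  { apply INR_lt. rewrite plus_INR. simpl. lra. }
  apply INR_lt in Hq1.
  (* One more index is given up at each end so that the dual cells of the nodes [S p] to [q] lie in
     [a,b]. Fewer than 3 cells are lost, at most half of [(b - a) * INR K] since this is at least
     6. *)
  set (p := S p0). set (q := (q0 - 1)%nat).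
  assert (HpR : INR p = INR p0 + 1) by apply S_INR.
  assert (HqR : INR q = INR q0 - 1) by (unfold q; rewrite minus_INR by lia; reflexivity).
  assert (HpqN : (p < q < K)%nat) by (unfold p, q; lia).
  assert (Hdrop : forall j, (p <= j < q)%nat -> lam * Y * (/ INR K * h0) <= - sv K s (S j) - - sv K s j).
  { intros j [Hj1 Hj2]. rewrite sv_S.
    assert (HjR1 := le_INR _ _ Hj1). assert (HjR2 := le_INR _ _ Hj2). rewrite S_INR in HjR2.
    assert (HFj : Y <= F (su K s (S j))).
    { apply HF. split; [| rewrite <- Hmax; apply prefix_max_ge; lia].
      apply Rle_div_l; [exact HK0a |]. rewrite Rmult_comm.
      destruct (prefix_max_attained (su K s) K) as [m [Hm Heq]]. fold (smax K s) in Heq.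
      rewrite Hmax in Heq. rewrite <- Heq.
      apply (chain_harnack gl gu K0 gl_mono gu_mono gl_ge0 gu_ge0 K0_ge0 gu_gl K (/ INR K)
        (Rlt_le _ _ HdK) _ (sv K s)); auto; try lia; rewrite S_INR; nra. }
    assert (Hcell : / INR K * h0 <= cell_mass h K (S j)).
    { assert (Hint : forall t, (INR (S j) - 1 / 2) / INR K <= t <= (INR (S j) + 1 / 2) / INR K ->
        a <= t <= b).
      { rewrite S_INR. intros t [Ht1 Ht2]. apply Rle_div_l in Ht1; [| exact HKpos].
        apply Rle_div_r in Ht2; [| exact HKpos]. split; nra. }
      destruct (cell_interval K (S j) ltac:(lia)) as [_ [_ Hw]].
      destruct (continuity_ab_maj h a b ltac:(lra)) as [Mx [HMx _]].
      { intros c Hc. apply h_cont. lra. }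
      apply (cell_mass_bounds h h_cont K (S j) h0 (h Mx)); [lia |].
      intros t Ht. split; [apply Hh | apply HMx]; apply Hint, Ht. }
    assert (0 <= / INR K * h0) by (apply Rmult_le_pos; lra).
    generalize (Rmult_le_compat _ _ _ _ HY H HFj Hcell). nra. }
  apply (telescope_ge (fun j => - sv K s j) _ p q ltac:(lia)) in Hdrop.
  assert (HD : sv K s p - sv K s q >= (b - a) * (lam * Y * h0) / 2).
  { assert (Hc : 0 <= lam * Y * h0) by (repeat apply Rmult_le_pos; lra).
    assert (Hlen : (b - a) / 2 <= (INR q - INR p) * / INR K).
    { apply (Rle_div_r _ _ _ HKpos). lra. }
    generalize (Rmult_le_compat_r _ _ _ Hc Hlen). lra. }
  destruct (chain_flux_drop gl gu gl_mono gl_ge0 K (/ INR K) (Rlt_le _ _ HdK) (su K s) (sv K s) p q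
    ((b - a) * (lam * Y * h0) / 2) a0 C) as [i [Hi Hlow]]; auto.
  - unfold su; simpl; lra.
  - apply Rmult_le_pos; [| lra]. repeat apply Rmult_le_pos; lra.
  - apply (Rle_div_r _ _ _ HKpos). rewrite S_INR. nra.
  - apply (Rle_div_r _ _ _ HKpos). rewrite minus_INR by lia. nra.
  - generalize (prefix_max_ge (su K s) K i Hi). fold (smax K s). rewrite Hmax.
    replace ((b - a) * (lam * Y * h0) / 2 / 2) with ((b - a) * (lam * Y * h0) / 4) in Hlow by field.
    lra.
Qed.


(** * Grid functions and their limits along the ultrafilter *)

Section Limit.

Context (G : (nat -> Prop) -> Prop) (HG : nonprincipal_ultrafilter G).

Definition floor_index (n : nat) (t : R) : nat :=
  Z.to_nat (Int_part (t * INR (2 * n + 1))).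

Lemma mesh_pos n : 0 < INR (2 * n + 1).
Proof. apply lt_0_INR. lia. Qed.

Lemma floor_index_spec n t : 0 <= t ->
  INR (floor_index n t) <= t * INR (2 * n + 1) < INR (floor_index n t) + 1.
Proof.
  intros Ht. assert (Hx : 0 <= t * INR (2 * n + 1)).
  { apply Rmult_le_pos; [exact Ht | apply pos_INR]. }
  unfold floor_index. set (x := t * INR (2 * n + 1)) in *.
  destruct (base_Int_part x) as [H1 H2].
  assert (Hz : (0 <= Int_part x)%Z).
  { assert (H : (-1 < Int_part x)%Z); [apply lt_IZR; simpl; lra | lia]. }
  rewrite INR_IZR_INZ, Z2Nat.id by exact Hz. lra.
Qed.

Lemma floor_index_div n t : 0 <= t ->
  INR (floor_index n t) / INR (2 * n + 1) <= t < INR (floor_index n t) / INR (2 * n + 1) + / INR (2 * n + 1).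
Proof.
  intros Ht. destruct (floor_index_spec n t Ht) as [H1 H2]. generalize (mesh_pos n). intros HK.
  split; [apply Rle_div_l; lra |].
  replace (INR (floor_index n t) / INR (2 * n + 1) + / INR (2 * n + 1))
    with ((INR (floor_index n t) + 1) / INR (2 * n + 1)) by (field; lra).
  apply Rlt_div_r; lra.
Qed.

Lemma floor_index_le n t : 0 <= t <= 1 -> (floor_index n t <= 2 * n + 1)%nat.
Proof.
  intros Ht. destruct (floor_index_spec n t ltac:(lra)) as [H1 _]. generalize (mesh_pos n). intros HK.
  apply INR_le. nra.
Qed.

Lemma floor_index_mono n s t : 0 <= s <= t -> (floor_index n s <= floor_index n t)%nat.
Proof.
  intros H. destruct (floor_index_spec n s ltac:(lra)) as [H1 _], (floor_index_spec n t ltac:(lra)) as [_ H2].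
  generalize (mesh_pos n). intros HK.
  assert (Hlt : INR (floor_index n s) < INR (floor_index n t) + 1) by nra.
  rewrite <- S_INR in Hlt. apply INR_lt in Hlt. lia.
Qed.

Lemma floor_index_tends t : 0 <= t ->
  tends G (fun n => INR (floor_index n t) / INR (2 * n + 1)) t.
Proof.
  intros Ht. apply (tends_squeeze G HG _ _ 1). apply (ultra_all G HG). intros n.
  generalize (floor_index_div n t Ht). rewrite INR_odd. intros. unfold Rdiv at 2. rewrite Rmult_1_l.
  apply Rabs_le. lra.
Qed.

Lemma ultra_mesh e : 0 < e -> G (fun n => / INR (2 * n + 1) < e).
Proof.
  intros He. destruct (nfloor_ex (/ e)) as [N [_ HN]]; [apply Rlt_le, Rinv_0_lt_compat, He |].
  apply (ultra_mono _ HG _ _ (ultra_ge _ HG N)). intros n Hn. apply le_INR in Hn.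
  rewrite <- (Rinv_inv e). apply Rinv_lt_contravar.
  - apply Rmult_lt_0_compat; [apply Rinv_0_lt_compat, He | apply mesh_pos].
  - rewrite INR_odd. generalize (pos_INR n). lra.
Qed.

Definition index_near (n j : nat) (t0 eta : R) : Prop :=
  Rabs (INR j / INR (2 * n + 1) - t0) < eta.

(** Convergence uniform over all nodes near [t0], not only at [floor_index n t0]: an increment of
    the limit is built from steps taken at many neighbouring nodes. *)
Definition tends_near (y : nat -> nat -> R) (t0 l : R) : Prop :=
  forall e, 0 < e -> exists eta, 0 < eta /\
    G (fun n => forall j, index_near n j t0 eta -> Rabs (y n j - l) < e).

Lemma index_between n i j k t0 eta : (i <= k <= j)%nat ->
  index_near n i t0 eta -> index_near n j t0 eta -> index_near n k t0 eta.
Proof.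
  unfold index_near. intros [H1 H2] Hi Hj. apply le_INR in H1. apply le_INR in H2.
  assert (HK : 0 <= / INR (2 * n + 1)) by (apply Rlt_le, Rinv_0_lt_compat, mesh_pos).
  generalize (Rmult_le_compat_r _ _ _ HK H1) (Rmult_le_compat_r _ _ _ HK H2). intros.
  apply Rabs_def2 in Hi. apply Rabs_def2 in Hj. apply Rabs_def1; unfold Rdiv in *; lra.
Qed.

Lemma index_near_S n j t0 eta : index_near n j t0 (eta / 2) -> / INR (2 * n + 1) < eta / 2 ->
  index_near n (S j) t0 eta.
Proof.
  unfold index_near. intros H1 H2. apply Rabs_def2 in H1. rewrite S_INR.
  assert (0 < / INR (2 * n + 1)) by (apply Rinv_0_lt_compat, mesh_pos).
  apply Rabs_def1; unfold Rdiv in *; lra.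
Qed.

Lemma index_near_weaken n j t0 e1 e2 : index_near n j t0 e1 -> e1 <= e2 -> index_near n j t0 e2.
Proof. unfold index_near. lra. Qed.

Lemma telescope_near (y : nat -> nat -> R) n (A e : R) i j :
  (i <= j)%nat ->
  (forall k, (i <= k < j)%nat -> Rabs (y n (S k) - y n k - A / INR (2 * n + 1)) <= e / INR (2 * n + 1)) ->
  Rabs (y n j - y n i - A * (INR j / INR (2 * n + 1) - INR i / INR (2 * n + 1)))
  <= e * (INR j / INR (2 * n + 1) - INR i / INR (2 * n + 1)).
Proof.
  intros Hij H. set (K := INR (2 * n + 1)) in *.
  assert (HK : 0 < K) by apply mesh_pos.
  assert (H1 : (INR j - INR i) * (A / K - e / K) <= y n j - y n i).
  { apply telescope_ge; [exact Hij |]. intros k Hk.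
    generalize (proj1 (Rabs_le_between _ _) (H k Hk)). lra. }
  assert (H2 : y n j - y n i <= (INR j - INR i) * (A / K + e / K)).
  { apply telescope_le; [exact Hij |]. intros k Hk.
    generalize (proj1 (Rabs_le_between _ _) (H k Hk)). lra. }
  apply Rabs_le.
  replace (A * (INR j / K - INR i / K)) with ((INR j - INR i) * (A / K)) by (field; lra).
  replace (e * (INR j / K - INR i / K)) with ((INR j - INR i) * (e / K)) by (field; lra). lra.
Qed.

(** Equicontinuity: two nodes within [r] of [t0] are at most [2 * r] apart, so their values differ
    by at most [2 * L * r <= e / 2]; convergence at the single node [floor_index n t0] then
    suffices. *)
Lemma tends_near_of_lipschitz y t0 l L eta : 0 <= t0 -> 0 < eta -> 0 < L ->
  tends G (fun n => y n (floor_index n t0)) l ->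
  G (fun n => forall j, index_near n j t0 eta ->
       Rabs (y n (S j) - y n j) <= L / INR (2 * n + 1)) ->
  tends_near y t0 l.
Proof.
  intros Ht0 Heta HL Hl Hstep e He.
  set (r := Rmin eta (e / (4 * L))).
  assert (Hr : 0 < r) by (apply Rmin_glb_lt; [exact Heta | apply Rdiv_lt_0_compat; lra]).
  assert (Hr1 : r <= eta) by apply Rmin_l.
  assert (Hr2 : L * r <= e / 4).
  { apply Rle_trans with (L * (e / (4 * L))); [apply Rmult_le_compat_l; [lra | apply Rmin_r] |].
    right. field. lra. }
  exists r. split; [exact Hr |].
  apply (ultra_mono _ HG _ _ (ultra_and _ HG _ _ Hstep
    (ultra_and _ HG _ _ (Hl (e / 2) ltac:(lra)) (ultra_mesh r Hr)))).
  intros n [H1 [H2 H3]] j Hj. set (k := floor_index n t0) in *.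
  assert (Hk : index_near n k t0 r).
  { generalize (floor_index_div n t0 Ht0). intros. apply Rabs_def1; unfold k; lra. }
  assert (Hjk : forall a b, (a <= b)%nat -> index_near n a t0 r -> index_near n b t0 r ->
    Rabs (y n b - y n a) <= e / 2).
  { intros a b Hab Ha Hb.
    assert (Ht := telescope_near y n 0 L a b Hab).
    rewrite Rmult_0_l, Rminus_0_r in Ht.
    apply Rle_trans with (1 := Ht ltac:(intros i Hi; unfold Rdiv at 1; rewrite Rmult_0_l, Rminus_0_r;
      apply H1; apply (index_near_weaken _ _ _ r eta); [apply (index_between n a b); auto; lia | exact Hr1])).
    unfold index_near in Ha, Hb. apply Rabs_def2 in Ha. apply Rabs_def2 in Hb. nra. }
  assert (Hd : Rabs (y n j - y n k) <= e / 2).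
  { destruct (Nat.le_ge_cases k j) as [Hle | Hle]; [apply Hjk; auto |].
    rewrite Rabs_minus_sym. apply Hjk; auto. }
  replace (y n j - l) with ((y n j - y n k) + (y n k - l)) by ring.
  apply Rle_lt_trans with (1 := Rabs_triang _ _). lra.
Qed.

(** Steps that all agree with [A / INR (2 * n + 1)] up to a small multiple of the mesh add up to
    increments that agree with [A] times the node distance. This inequality passes to the limit and
    bounds the difference quotient directly, with no integral equation in between. *)
Lemma derivable_of_increments y (L : R -> R) t0 A lo hi : 0 <= lo < t0 -> t0 < hi ->
  (forall t, lo < t < hi -> tends G (fun n => y n (floor_index n t)) (L t)) ->
  (forall e, 0 < e -> exists eta, 0 < eta /\ G (fun n => forall j, index_near n j t0 eta ->
     Rabs (y n (S j) - y n j - A / INR (2 * n + 1)) <= e / INR (2 * n + 1))) ->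
  derivable_pt_lim L t0 A.
Proof.
  intros Hlo Hhi Hlim Hinc e He.
  destruct (Hinc (e / 2) ltac:(lra)) as [eta [Heta HGeta]].
  set (r := Rmin (eta / 2) (Rmin (t0 - lo) (hi - t0))).
  assert (Hr : 0 < r) by (repeat apply Rmin_glb_lt; lra).
  assert (Hr1 : r <= eta / 2) by apply Rmin_l.
  assert (Hr2 : r <= t0 - lo) by (apply Rle_trans with (1 := Rmin_r _ _), Rmin_l).
  assert (Hr3 : r <= hi - t0) by (apply Rle_trans with (1 := Rmin_r _ _), Rmin_r).
  assert (Hst : forall s t, s <= t -> t0 - r < s -> t < t0 + r ->
    Rabs (L t - L s - A * (t - s)) <= e / 2 * (t - s)).
  { intros s t Hs1 Hs2 Hs3.
    assert (HLt := Hlim t ltac:(lra)). assert (HLs := Hlim s ltac:(lra)).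
    assert (Hxt := floor_index_tends t ltac:(lra)). assert (Hxs := floor_index_tends s ltac:(lra)).
    assert (HX := tends_minus _ HG _ _ _ _ Hxt Hxs).
    assert (HY := tends_minus _ HG _ _ _ _ (tends_minus _ HG _ _ _ _ HLt HLs) (tends_scal _ HG _ _ A HX)).
    assert (HE : G (fun n => Rabs (y n (floor_index n t) - y n (floor_index n s) -
      A * (INR (floor_index n t) / INR (2 * n + 1) - INR (floor_index n s) / INR (2 * n + 1))) <=
      e / 2 * (INR (floor_index n t) / INR (2 * n + 1) - INR (floor_index n s) / INR (2 * n + 1)))).
    { apply (ultra_mono _ HG _ _ (ultra_and _ HG _ _ HGeta (ultra_mesh (eta / 2) ltac:(lra)))).
      intros n [H1 H2].
      assert (Hnear : forall z, t0 - r < z < t0 + r -> index_near n (floor_index n z) t0 eta).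
      { intros z Hz. generalize (floor_index_div n z ltac:(lra)). intros. apply Rabs_def1; lra. }
      apply telescope_near; [apply floor_index_mono; lra |].
      intros k Hk. apply H1. apply (index_between n (floor_index n s) (floor_index n t)); [lia | |];
        apply Hnear; lra. }
    assert (HS := tends_scal _ HG _ _ (e / 2) HX).
    apply Rabs_le. split.
    - assert (Hneg := tends_scal _ HG _ _ (-1) HS).
      apply Ropp_le_cancel.
      replace (- - (e / 2 * (t - s))) with (e / 2 * (t - s)) by ring.
      assert (HYn := tends_scal _ HG _ _ (-1) HY).
      replace (- (L t - L s - A * (t - s))) with (-1 * (L t - L s - A * (t - s))) by ring.
      apply (tends_le _ HG _ _ _ _ HYn HS).
      apply (ultra_mono _ HG _ _ HE). intros n Hn. cbv beta.
      apply Rabs_le_between in Hn. lra.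
    - apply (tends_le _ HG _ _ _ _ HY HS).
      apply (ultra_mono _ HG _ _ HE). intros n Hn. cbv beta.
      apply Rabs_le_between in Hn. lra. }
  exists (mkposreal r Hr). intros x Hx Hxr. simpl in Hxr. apply Rabs_def2 in Hxr.
  assert (Hq : Rabs (L (t0 + x) - L t0 - A * x) <= e / 2 * Rabs x).
  { destruct (Rle_lt_dec 0 x) as [H0 | H0].
    - generalize (Hst t0 (t0 + x) ltac:(lra) ltac:(lra) ltac:(lra)).
      rewrite (Rabs_right x) by lra. replace (t0 + x - t0) with x by ring. auto.
    - generalize (Hst (t0 + x) t0 ltac:(lra) ltac:(lra) ltac:(lra)).
      rewrite (Rabs_left x) by lra. replace (t0 - (t0 + x)) with (- x) by ring.
      rewrite <- (Rabs_Ropp (L (t0 + x) - L t0 - A * x)).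
      replace (- (L (t0 + x) - L t0 - A * x)) with (L t0 - L (t0 + x) - A * - x) by ring. auto. }
  replace ((L (t0 + x) - L t0) / x - A) with ((L (t0 + x) - L t0 - A * x) * / x) by (field; exact Hx).
  rewrite Rabs_mult, Rabs_inv. assert (Hxp : 0 < Rabs x) by (apply Rabs_pos_lt, Hx).
  apply Rle_lt_trans with (e / 2 * Rabs x * / Rabs x).
  - apply Rmult_le_compat_r; [apply Rlt_le, Rinv_0_lt_compat, Hxp | exact Hq].
  - rewrite Rmult_assoc, Rinv_r by lra. lra.
Qed.

(** * Compactness of a bounded family of discrete solutions *)

Context (s : nat -> R) (n0 : nat) (Rm : R) (Rm_pos : 0 < Rm).
Context (s_root : forall n, (n0 <= n)%nat -> su (2 * n + 1) (s n) (2 * n + 1) = 0).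
Context (s_max : forall n, (n0 <= n)%nat -> smax (2 * n + 1) (s n) <= Rm).
Context (g_joint : forall t x e, 0 < t < 1 -> 0 < e -> exists r, 0 < r /\
  forall t' x', 0 < t' < 1 -> Rabs (t' - t) < r -> Rabs (x' - x) < r -> Rabs (g t' x' - g t x) < e).
Context (pinv : R -> R) (pinv_ge0 : forall y, 0 <= y -> 0 <= pinv y).
Context (left_sums : half_sums_controlled h pinv).
Context (right_sums : half_sums_controlled (fun t => h (1 - t)) pinv).
Context (B Ck : R) (B_pos : 0 < B) (Ck_ge0 : 0 <= Ck).
Context (F_le_B : forall x, x <= Rm -> F x <= B).
Context (gu_split : forall A y, 0 <= A -> 0 <= y -> gu (A + lam * B * y) <= gu (2 * A) + Ck * pinv y).

Let U n j := su (2 * n + 1) (s n) j.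
Let V n j := sv (2 * n + 1) (s n) j.

Lemma U_chain n : chain gl gu (2 * n + 1) (/ INR (2 * n + 1)) (U n) (V n).
Proof. apply shoot_chain. Qed.

Lemma mesh_inv_ge0 n : 0 <= / INR (2 * n + 1).
Proof. apply Rlt_le, Rinv_0_lt_compat, mesh_pos. Qed.

Lemma U_range n j : (n0 <= n)%nat -> (j <= 2 * n + 1)%nat -> 0 <= U n j <= Rm.
Proof.
  intros Hn Hj. split.
  - apply (chain_ge0 gl gu gl_mono gl_ge0 _ _ (mesh_inv_ge0 n) _ _ j (U_chain n) Hj).
    + unfold U, su. simpl. lra.
    + unfold U. rewrite s_root by exact Hn. lra.
  - apply Rle_trans with (2 := s_max n Hn). apply prefix_max_ge, Hj.
Qed.

(** A flux beyond [b] would carry [u] above [Rm] over a stretch of length [a]. The bound depends on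
    the distance [a] to the ends and not on [n]. *)
Lemma V_bound a : 0 < a -> exists b, 0 < b /\ forall n j, (n0 <= n)%nat -> (j < 2 * n + 1)%nat ->
  a * INR (2 * n + 1) <= INR j + 1 -> a * INR (2 * n + 1) <= INR (2 * n + 1) - INR j ->
  Rabs (V n j) <= b.
Proof.
  intros Ha. destruct (gl_large (Rm / a)) as [b [Hb Hgb]]. exists b. split; [exact Hb |].
  intros n j Hn Hj H1 H2. assert (HK := mesh_pos n).
  apply (chain_flux_bound_abs gl gu gl_mono gl_ge0 _ _ (mesh_inv_ge0 n) (U n) (V n) Rm j b a
    (U_chain n)); try lra.
  - intros i Hi. apply U_range; auto.
  - exact Hj.
  - apply (Rle_div_r _ _ _ HK). rewrite S_INR. exact H1.
  - apply (Rle_div_r _ _ _ HK). rewrite minus_INR by lia. exact H2.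
  - rewrite Rmult_comm. apply (Rlt_div_l _ _ _ Ha). exact Hgb.
Qed.

Lemma V_step n j : (n0 <= n)%nat -> (S j < 2 * n + 1)%nat ->
  V n j - V n (S j) = lam * F (U n (S j)) * cell_mass h (2 * n + 1) (S j) /\
  0 <= F (U n (S j)) <= B.
Proof.
  intros Hn Hj. split; [unfold V, U; rewrite sv_S; ring |].
  split; [apply F_ge0 | apply F_le_B, U_range; auto; lia].
Qed.

(** [epsilon] gives total functions that are meaningful only where the limit is shown to exist: on
    [0,1] for [U_lim], but on (0,1) for [V_lim], no bound in [n] being available for the initial
    fluxes [s n]. *)
Definition U_lim t := epsilon (inhabits 0) (tends G (fun n => U n (floor_index n t))).
Definition V_lim t := epsilon (inhabits 0) (tends G (fun n => V n (floor_index n t))).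

Lemma U_tends t : 0 <= t <= 1 -> tends G (fun n => U n (floor_index n t)) (U_lim t).
Proof.
  intros Ht. unfold U_lim. apply epsilon_spec. apply (tends_bounded G HG _ Rm).
  apply (ultra_mono _ HG _ _ (ultra_ge _ HG n0)). intros n Hn.
  destruct (U_range n (floor_index n t) Hn (floor_index_le n t Ht)). apply Rabs_le. lra.
Qed.

Lemma index_near_interior t a n j : a < t -> a < 1 - t ->
  index_near n j t (Rmin (t - a) (1 - t - a)) ->
  a * INR (2 * n + 1) <= INR j /\ a * INR (2 * n + 1) <= INR (2 * n + 1) - INR j.
Proof.
  intros H1 H2 H. apply Rabs_def2 in H.
  generalize (Rmin_l (t - a) (1 - t - a)) (Rmin_r (t - a) (1 - t - a)). intros.
  assert (HK := mesh_pos n). split.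
  - apply (Rle_div_r _ _ _ HK). lra.
  - assert (Hj : INR j / INR (2 * n + 1) <= 1 - a) by lra. apply (Rle_div_l _ _ _ HK) in Hj. lra.
Qed.

Lemma floor_index_near n t r : 0 <= t -> / INR (2 * n + 1) < r -> index_near n (floor_index n t) t r.
Proof.
  intros Ht Hr. generalize (floor_index_div n t Ht) (mesh_inv_ge0 n). intros.
  apply Rabs_def1; lra.
Qed.

Lemma interior_margin t : 0 < t < 1 -> exists a, 0 < a /\ a < t /\ a < 1 - t /\
  0 < Rmin (t - a) (1 - t - a).
Proof.
  intros Ht. exists (Rmin t (1 - t) / 2).
  assert (0 < Rmin t (1 - t)) by (apply Rmin_glb_lt; lra).
  generalize (Rmin_l t (1 - t)) (Rmin_r t (1 - t)). intros.
  repeat split; try lra. apply Rmin_glb_lt; lra.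
Qed.

Lemma index_lt n j a : 0 < a -> a * INR (2 * n + 1) <= INR (2 * n + 1) - INR j -> (j < 2 * n + 1)%nat.
Proof. intros Ha H. assert (HK := mesh_pos n). apply INR_lt. nra. Qed.

Lemma V_near_bound t : 0 < t < 1 -> exists b eta, 0 < b /\ 0 < eta /\
  forall n j, (n0 <= n)%nat -> index_near n j t eta -> (j < 2 * n + 1)%nat /\ Rabs (V n j) <= b.
Proof.
  intros Ht. destruct (interior_margin t Ht) as [a [Ha [H1 [H2 H3]]]].
  destruct (V_bound a Ha) as [b [Hb HV]].
  exists b, (Rmin (t - a) (1 - t - a)). repeat split; try assumption;
    destruct (index_near_interior t a n j H1 H2 H0).
  - apply (index_lt n j a); auto.
  - apply HV; auto; [apply (index_lt n j a); auto | lra].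
Qed.

Lemma V_tends t : 0 < t < 1 -> tends G (fun n => V n (floor_index n t)) (V_lim t).
Proof.
  intros Ht. unfold V_lim. apply epsilon_spec.
  destruct (V_near_bound t Ht) as [b [eta [Hb [Heta HV]]]].
  apply (tends_bounded G HG _ b).
  apply (ultra_mono _ HG _ _ (ultra_and _ HG _ _ (ultra_ge _ HG n0) (ultra_mesh eta Heta))).
  intros n [Hn Hm]. apply HV; auto. apply floor_index_near; lra.
Qed.

Lemma U_near t : 0 < t < 1 -> tends_near U t (U_lim t).
Proof.
  intros Ht. destruct (V_near_bound t Ht) as [b [eta [Hb [Heta HV]]]].
  apply (tends_near_of_lipschitz U t (U_lim t) (gu b + 1) eta); auto; try lra.
  - generalize (gu_ge0 b ltac:(lra)). lra.
  - apply U_tends. lra.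
  - apply (ultra_mono _ HG _ _ (ultra_ge _ HG n0)). intros n Hn j Hj.
    destruct (HV n j Hn Hj) as [HjK HVj]. apply Rabs_le_between in HVj.
    assert (HK := mesh_inv_ge0 n). unfold Rdiv. rewrite (Rmult_comm _ (/ _)).
    destruct (Rle_lt_dec 0 (V n j)) as [Hs | Hs].
    + destruct (chain_up _ _ _ _ _ _ (U_chain n) j HjK Hs) as [Ha Hb'].
      assert (gu (V n j) <= gu b) by (apply gu_mono; lra).
      generalize (Rmult_le_pos _ _ HK (gl_ge0 _ Hs)). intros.
      rewrite Rabs_right by lra. apply Rle_trans with (1 := Hb'), Rmult_le_compat_l; lra.
    + destruct (chain_down _ _ _ _ _ _ (U_chain n) j HjK ltac:(lra)) as [Ha Hb'].
      assert (gu (- V n j) <= gu b) by (apply gu_mono; lra).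
      generalize (Rmult_le_pos _ _ HK (gl_ge0 (- V n j) ltac:(lra))). intros.
      rewrite Rabs_minus_sym, Rabs_right by lra.
      apply Rle_trans with (1 := Hb'), Rmult_le_compat_l; lra.
Qed.

(** The mass of a dual cell divided by its length is an average of [h], hence close to [h t]. The
    node is [S j] because its mass is the one that separates the fluxes [j] and [S j]. *)
Lemma cell_mass_near t e : 0 < t < 1 -> 0 < e -> exists eta, 0 < eta /\
  G (fun n => forall j, index_near n j t eta ->
    (S j < 2 * n + 1)%nat /\
    Rabs (INR (2 * n + 1) * cell_mass h (2 * n + 1) (S j) - h t) <= e).
Proof.
  intros Ht He. destruct (h_cont t Ht e He) as [r [Hr Hcont]].
  destruct (interior_margin t Ht) as [a [Ha [H1 [H2 H3]]]].
  set (q := Rmin r (Rmin (t - a) (1 - t - a))).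
  assert (Hq : 0 < q) by (apply Rmin_glb_lt; [exact Hr | exact H3]).
  assert (Hq1 : q <= r) by apply Rmin_l. assert (Hq2 : q <= Rmin (t - a) (1 - t - a)) by apply Rmin_r.
  exists (q / 4). split; [lra |].
  apply (ultra_mono _ HG _ _ (ultra_mesh (q / 4) ltac:(lra))). intros n Hn j Hj.
  assert (HK := mesh_pos n).
  assert (HSj : index_near n (S j) t (q / 2)).
  { apply index_near_S; [replace (q / 2 / 2) with (q / 4) by field; exact Hj | lra]. }
  assert (HSa : index_near n (S j) t (Rmin (t - a) (1 - t - a))).
  { apply (index_near_weaken _ _ _ (q / 2)); [exact HSj | lra]. }
  destruct (index_near_interior t a n (S j) H1 H2 HSa) as [H4 H5].
  assert (HjK : (S j < 2 * n + 1)%nat) by (apply (index_lt n (S j) a); auto).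
  split; [exact HjK |].
  destruct (cell_mass_bounds h h_cont (2 * n + 1) (S j) (h t - e) (h t + e)) as [Hlo Hhi].
  - lia.
  - intros x Hx.
    assert (Hxt : Rabs (x - t) < r).
    { unfold index_near in HSj. apply Rabs_def2 in HSj. unfold Rdiv in Hx.
      rewrite Rmult_minus_distr_r, Rmult_plus_distr_r in Hx.
      unfold Rdiv in HSj. generalize (mesh_inv_ge0 n). intros. apply Rabs_def1; lra. }
    destruct (Req_dec x t) as [-> | Hne]; [lra |].
    specialize (Hcont x). simpl in Hcont. unfold R_dist in Hcont.
    assert (Hd : Rabs (h x - h t) < e).
    { apply Hcont. split; [split; [exact I | auto] | exact Hxt]. }
    apply Rabs_def2 in Hd. lra.
  - apply (Rmult_le_compat_l _ _ _ (Rlt_le _ _ HK)) in Hlo.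
    apply (Rmult_le_compat_l _ _ _ (Rlt_le _ _ HK)) in Hhi.
    rewrite <- Rmult_assoc, Rinv_r, Rmult_1_l in Hlo by lra.
    rewrite <- Rmult_assoc, Rinv_r, Rmult_1_l in Hhi by lra.
    apply Rabs_le. lra.
Qed.

Lemma V_near t : 0 < t < 1 -> tends_near V t (V_lim t).
Proof.
  intros Ht. destruct (cell_mass_near t 1 Ht Rlt_0_1) as [eta [Heta Hcell]].
  assert (Hht := h_ge0 t Ht).
  apply (tends_near_of_lipschitz V t (V_lim t) (lam * B * (h t + 1)) eta); auto; try lra.
  - repeat apply Rmult_lt_0_compat; lra.
  - apply V_tends, Ht.
  - apply (ultra_mono _ HG _ _ (ultra_and _ HG _ _ Hcell (ultra_ge _ HG n0))). intros n [Hc Hn] j Hj.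
    destruct (Hc j Hj) as [HjK Hm]. destruct (V_step n j Hn HjK) as [Hstep [HF0 HFB]].
    apply Rabs_le_between in Hm. assert (HK := mesh_pos n).
    assert (Hm0 := cell_mass_ge0 h h_cont h_ge0 (2 * n + 1) (S j) ltac:(lia)).
    rewrite Rabs_minus_sym, Hstep, Rabs_right
      by (apply Rle_ge; repeat apply Rmult_le_pos; lra).
    apply (Rle_div_r _ _ _ HK). rewrite !Rmult_assoc.
    apply Rmult_le_compat_l; [lra |]. rewrite (Rmult_comm _ (INR _)).
    apply Rmult_le_compat; try lra. apply Rmult_le_pos; lra.
Qed.

(** The step at [j] evaluates [g] at a cell midpoint and at a flux that both vary with [j] and [n];
    hence joint continuity of [g], and [V_near] rather than [V_tends]. *)
Lemma U_lim_derivable t : 0 < t < 1 -> derivable_pt_lim U_lim t (g t (V_lim t)).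
Proof.
  intros Ht. apply (derivable_of_increments U U_lim t _ 0 1); try lra.
  { intros x Hx. apply U_tends. lra. }
  intros e He. destruct (g_joint t (V_lim t) e Ht He) as [r [Hr Hg]].
  destruct (V_near t Ht r Hr) as [eta [Heta HV]].
  destruct (interior_margin t Ht) as [a [Ha [H1 [H2 H3]]]].
  set (q := Rmin (Rmin eta r) (Rmin (t - a) (1 - t - a))).
  assert (Hq : 0 < q) by (repeat apply Rmin_glb_lt; lra).
  assert (Hq1 : q <= eta) by (apply Rle_trans with (1 := Rmin_l _ _), Rmin_l).
  assert (Hq2 : q <= r) by (apply Rle_trans with (1 := Rmin_l _ _), Rmin_r).
  assert (Hq3 : q <= Rmin (t - a) (1 - t - a)) by apply Rmin_r.
  exists (q / 2). split; [lra |].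
  apply (ultra_mono _ HG _ _ (ultra_and _ HG _ _ HV (ultra_mesh (q / 2) ltac:(lra)))).
  intros n [HVn Hm] j Hj. assert (HK := mesh_pos n). assert (HKi := mesh_inv_ge0 n).
  assert (HjK : (j < 2 * n + 1)%nat).
  { apply (index_lt n j a Ha). apply (index_near_interior t a n j H1 H2).
    apply (index_near_weaken _ _ _ (q / 2)); [exact Hj | lra]. }
  unfold U. rewrite su_S.
  match goal with |- Rabs ?X <= _ => replace X with
    (/ INR (2 * n + 1) * (g ((INR j + 1 / 2) / INR (2 * n + 1)) (V n j) - g t (V_lim t))) end.
  2: { unfold V, Rdiv. ring. }
  rewrite Rabs_mult, (Rabs_right (/ _)), (Rmult_comm (/ _)) by lra.
  apply Rmult_le_compat_r; [exact HKi |]. apply Rlt_le, Hg.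
  - apply mid_node, HjK.
  - unfold index_near in Hj. apply Rabs_def2 in Hj. unfold Rdiv in *.
    rewrite Rmult_plus_distr_r. apply Rabs_def1; lra.
  - apply HVn. apply (index_near_weaken _ _ _ (q / 2)); [exact Hj | lra].
Qed.

Lemma V_lim_derivable t : 0 < t < 1 -> derivable_pt_lim V_lim t (- (lam * h t * F (U_lim t))).
Proof.
  intros Ht. apply (derivable_of_increments V V_lim t _ 0 1); try lra.
  { intros x Hx. apply V_tends. lra. }
  intros e He. assert (Hht := h_ge0 t Ht).
  (* The error of a step splits into an error of the cell mass, weighted by a value of [F] up to
     [B], and an error of [F], weighted by [h t]. After multiplication by [lam], the choices of [e1]
     and [e2] leave at most [e / 2] for each; the [+ 1] allows [h t = 0]. *)
  set (e1 := e / (2 * lam * (h t + 1))).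
  assert (He1 : 0 < e1) by (apply Rdiv_lt_0_compat; [lra | repeat apply Rmult_lt_0_compat; lra]).
  set (e2 := Rmin 1 (e / (2 * lam * B))).
  assert (He2 : 0 < e2).
  { apply Rmin_glb_lt; [lra |]. apply Rdiv_lt_0_compat; [lra | repeat apply Rmult_lt_0_compat; lra]. }
  destruct (F_cont (U_lim t) e1 He1) as [r [Hr HF]].
  destruct (U_near t Ht r Hr) as [eta [Heta HU]].
  destruct (cell_mass_near t e2 Ht He2) as [eta' [Heta' Hcell]].
  set (q := Rmin eta eta'). assert (Hq : 0 < q) by (apply Rmin_glb_lt; assumption).
  assert (Hq1 : q <= eta) by apply Rmin_l. assert (Hq2 : q <= eta') by apply Rmin_r.
  exists (q / 2). split; [lra |].
  apply (ultra_mono _ HG _ _ (ultra_and _ HG _ _ (ultra_and _ HG _ _ HU Hcell)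
    (ultra_and _ HG _ _ (ultra_ge _ HG n0) (ultra_mesh (q / 2) ltac:(lra))))).
  intros n [[HUn Hc] [Hn Hm]] j Hj. assert (HK := mesh_pos n).
  destruct (Hc j (index_near_weaken n j t (q / 2) eta' Hj ltac:(lra))) as [HjK Hcj].
  destruct (V_step n j Hn HjK) as [Hstep [HF0 HFB]].
  assert (HUj : Rabs (U n (S j) - U_lim t) < r).
  { apply HUn. apply (index_near_weaken _ _ _ q); [apply index_near_S; assumption | exact Hq1]. }
  assert (HFj : Rabs (F (U n (S j)) - F (U_lim t)) <= e1).
  { destruct (Req_dec (U n (S j)) (U_lim t)) as [-> | Hne].
    - rewrite Rminus_diag, Rabs_R0. lra.
    - apply Rlt_le, (HF (U n (S j))). split; [split; [exact I | auto] | exact HUj]. }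
  set (m := INR (2 * n + 1) * cell_mass h (2 * n + 1) (S j)) in *.
  assert (Hmass : cell_mass h (2 * n + 1) (S j) = m / INR (2 * n + 1)) by (unfold m; field; lra).
  replace (V n (S j) - V n j) with (- (V n j - V n (S j))) by ring. rewrite Hstep, Hmass.
  match goal with |- Rabs ?X <= _ => replace X with
    (- (lam * (F (U n (S j)) * (m - h t) + h t * (F (U n (S j)) - F (U_lim t))) / INR (2 * n + 1))) end.
  2: { field. lra. }
  rewrite Rabs_Ropp. unfold Rdiv. rewrite Rabs_mult, (Rabs_right (/ _))
    by (apply Rle_ge, mesh_inv_ge0).
  apply Rmult_le_compat_r; [apply mesh_inv_ge0 |].
  rewrite Rabs_mult, (Rabs_right lam) by lra.
  assert (Hfin : Rabs (F (U n (S j)) * (m - h t) + h t * (F (U n (S j)) - F (U_lim t))) <=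
    B * e2 + (h t + 1) * e1).
  { apply Rle_trans with (1 := Rabs_triang _ _). rewrite !Rabs_mult.
    rewrite (Rabs_right (F _)), (Rabs_right (h t)) by lra.
    apply Rplus_le_compat; apply Rmult_le_compat; try lra; apply Rabs_pos. }
  apply Rle_trans with (lam * (B * e2 + (h t + 1) * e1)); [apply Rmult_le_compat_l; lra |].
  assert (E1 : lam * ((h t + 1) * e1) = e / 2) by (unfold e1; field; lra).
  assert (E2 : lam * (B * e2) <= e / 2).
  { apply Rle_trans with (lam * (B * (e / (2 * lam * B)))).
    - apply Rmult_le_compat_l; [lra |]. apply Rmult_le_compat_l; [lra | apply Rmin_r].
    - right. field. lra. }
  lra.
Qed.

Lemma U_lim_le y t : 0 <= t <= 1 -> (forall n, (n0 <= n)%nat -> smax (2 * n + 1) (s n) <= y) ->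
  U_lim t <= y.
Proof.
  intros Ht Hy. apply (tends_le G HG _ _ _ _ (U_tends t Ht) (tends_const G HG y)).
  apply (ultra_mono _ HG _ _ (ultra_ge _ HG n0)). intros n Hn.
  apply Rle_trans with (2 := Hy n Hn). apply prefix_max_ge, floor_index_le, Ht.
Qed.

Lemma U_lim_ge0 t : 0 <= t <= 1 -> 0 <= U_lim t.
Proof.
  intros Ht. apply (tends_le G HG _ _ _ _ (tends_const G HG 0) (U_tends t Ht)).
  apply (ultra_mono _ HG _ _ (ultra_ge _ HG n0)). intros n Hn.
  apply U_range; [exact Hn | apply floor_index_le, Ht].
Qed.

(** The discrete maximum may sit at a node that moves with [n], so pointwise limits do not see it;
    the Harnack inequality transfers it to the fixed point [t] at the cost of a constant factor. *)
Lemma U_lim_lower y t a : 0 < a -> a < t -> a < 1 - t ->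
  (forall n, (n0 <= n)%nat -> y <= smax (2 * n + 1) (s n)) ->
  y <= (1 + K0 / a) * U_lim t.
Proof.
  intros Ha H1 H2 Hy.
  apply (tends_le G HG _ _ _ _ (tends_const G HG y)
    (tends_scal G HG _ _ (1 + K0 / a) (U_tends t ltac:(lra)))).
  assert (Hr : 0 < Rmin (t - a) (1 - t - a)) by (apply Rmin_glb_lt; lra).
  apply (ultra_mono _ HG _ _ (ultra_and _ HG _ _ (ultra_ge _ HG n0) (ultra_mesh _ Hr))).
  intros n [Hn Hm]. assert (HK := mesh_pos n).
  destruct (index_near_interior t a n _ H1 H2 (floor_index_near n t _ ltac:(lra) Hm)) as [H3 H4].
  apply Rle_trans with (1 := Hy n Hn).
  destruct (prefix_max_attained (su (2 * n + 1) (s n)) (2 * n + 1)) as [m [Hmm Heq]].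
  unfold smax. rewrite <- Heq.
  apply (chain_harnack gl gu K0 gl_mono gu_mono gl_ge0 gu_ge0 K0_ge0 gu_gl (2 * n + 1)
    (/ INR (2 * n + 1)) (mesh_inv_ge0 n) _ (V n)); auto.
  - apply U_chain.
  - intros j Hj. apply U_range; auto.
  - split; [| apply (index_lt n _ a); auto].
    apply INR_lt. simpl. nra.
Qed.

(** [chain_left_estimate] is started from the middle cell, whose flux is bounded by [b] uniformly in
    [n]. The linear term is small with [INR m / INR (2 * n + 1)], the midpoint sum by uniform
    integrability. [u] and [v] are arbitrary so that the reversed family is covered as well. *)
Lemma edge_small (u v : nat -> nat -> R) w : (forall t, 0 < t < 1 -> continuity_pt w t) ->
  (forall t, 0 < t < 1 -> 0 <= w t) -> half_sums_controlled w pinv ->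
  (forall n, (n0 <= n)%nat -> chain gl gu (2 * n + 1) (/ INR (2 * n + 1)) (u n) (v n) /\ u n O = 0 /\
    forall j, (S j < 2 * n + 1)%nat -> v n j - v n (S j) <= lam * B * cell_mass w (2 * n + 1) (S j)) ->
  (exists b, 0 < b /\ forall n, (n0 <= n)%nat -> v n n <= b) ->
  forall e, 0 < e -> exists r, 0 < r /\ forall n m, (n0 <= n)%nat -> (m <= n)%nat ->
    INR m / INR (2 * n + 1) <= r -> u n m <= e.
Proof.
  intros Hw Hw0 [_ Htail] Hu [b [Hb Hvb]] e He.
  destruct (Htail (e / (2 * (Ck + 1))) ltac:(apply Rdiv_lt_0_compat; lra)) as [t1 [Ht1 Hsum]].
  assert (Hgu := gu_ge0 (2 * b) ltac:(lra)).
  set (r := Rmin t1 (e / (2 * (gu (2 * b) + 1)))).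
  assert (Hr : 0 < r) by (apply Rmin_glb_lt; [exact Ht1 | apply Rdiv_lt_0_compat; lra]).
  exists r. split; [exact Hr |]. intros n m Hn Hm Hmr.
  destruct (Hu n Hn) as [C [H0 Hstep]].
  assert (HlB : 0 <= lam * B) by (apply Rmult_le_pos; lra).
  generalize (chain_left_estimate w Hw Hw0 pinv pinv_ge0 (lam * B) Ck HlB Ck_ge0 gu_split
    n (u n) (v n) b n m C Hstep (Rlt_le _ _ Hb) (Hvb n Hn) ltac:(lia)). rewrite H0, Rminus_0_r.
  intros Hle. apply Rle_trans with (1 := Hle).
  assert (E1 : INR m / INR (2 * n + 1) * gu (2 * b) <= e / 2).
  { apply Rle_trans with (e / (2 * (gu (2 * b) + 1)) * (gu (2 * b) + 1)).
    - apply Rmult_le_compat; try lra.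
      + apply Rdiv_le_0_compat; [apply pos_INR | apply mesh_pos].
      + apply Rle_trans with (1 := Hmr), Rmin_r.
    - right. field. lra. }
  assert (E2 : Ck * half_sum w pinv n m <= e / 2).
  { assert (Hs := Hsum n m Hm (Rle_trans _ _ _ Hmr (Rmin_l _ _))).
    apply Rle_trans with (Ck * (e / (2 * (Ck + 1)))); [apply Rmult_le_compat_l; assumption |].
    apply Rle_trans with ((Ck + 1) * (e / (2 * (Ck + 1)))).
    - apply Rmult_le_compat_r; [apply Rlt_le, Rdiv_lt_0_compat; lra | lra].
    - right. field. lra. }
  lra.
Qed.

Lemma V_middle : exists b, 0 < b /\ forall n, (n0 <= n)%nat -> Rabs (V n n) <= b.
Proof.
  destruct (V_bound (1 / 4) ltac:(lra)) as [b [Hb HV]]. exists b. split; [exact Hb |].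
  intros n Hn. apply HV; auto; [lia | |]; rewrite INR_odd; generalize (pos_INR n); lra.
Qed.

Lemma U_lim_at_0 e : 0 < e -> exists r, 0 < r /\ forall t, 0 <= t < r -> U_lim t <= e.
Proof.
  intros He. destruct V_middle as [b [Hb HV]].
  destruct (edge_small U V h h_cont h_ge0 left_sums) with (e := e) as [r [Hr Hsmall]]; auto.
  - intros n Hn. split; [apply U_chain | split; [reflexivity |]].
    intros j Hj. destruct (V_step n j Hn Hj) as [-> [HF0 HFB]].
    apply Rmult_le_compat_r; [apply (cell_mass_ge0 h h_cont h_ge0); lia |].
    apply Rmult_le_compat_l; lra.
  - exists b. split; [exact Hb |]. intros n Hn. generalize (proj1 (Rabs_le_between _ _) (HV n Hn)). lra.
  (* With [t < 1 / 4] and [n >= 1] the node of [t] lies in the left half, since (2n+1)/4 <= n. *)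
  - exists (Rmin r (1 / 4)). split; [apply Rmin_glb_lt; lra |]. intros t Ht.
    generalize (Rmin_l r (1 / 4)) (Rmin_r r (1 / 4)). intros.
    apply (tends_le G HG _ _ _ _ (U_tends t ltac:(lra)) (tends_const G HG e)).
    apply (ultra_mono _ HG _ _ (ultra_and _ HG _ _ (ultra_ge _ HG n0) (ultra_ge _ HG 1%nat))).
    intros n [Hn Hn1].
    apply Hsmall; [exact Hn | |].
    + destruct (floor_index_spec n t ltac:(lra)) as [Hf _]. rewrite INR_odd in Hf.
      apply INR_le. apply le_INR in Hn1. simpl in Hn1. nra.
    + destruct (floor_index_div n t ltac:(lra)). lra.
Qed.

Lemma U_lim_at_1 e : 0 < e -> exists r, 0 < r /\ forall t, 1 - r < t <= 1 -> U_lim t <= e.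
Proof.
  intros He. destruct V_middle as [b [Hb HV]].
  destruct (edge_small (fun n j => U n (2 * n + 1 - j)%nat) (fun n j => - V n (2 * n + 1 - 1 - j)%nat)
    (fun t => h (1 - t)) reflect_cont reflect_ge0 right_sums) with (e := e) as [r [Hr Hsmall]]; auto.
  - intros n Hn. split; [apply chain_rev, U_chain |]. split.
    + rewrite Nat.sub_0_r. apply s_root, Hn.
    + intros j Hj. apply (chain_rev_step h (lam * B) (2 * n + 1) (V n) h_cont); [| exact Hj].
      clear j Hj. intros j Hj. destruct (V_step n j Hn Hj) as [-> [HF0 HFB]].
      apply Rmult_le_compat_r; [apply (cell_mass_ge0 h h_cont h_ge0); lia |].
      apply Rmult_le_compat_l; lra.
  - exists b. split; [exact Hb |]. intros n Hn. replace (2 * n + 1 - 1 - n)%nat with n by lia.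
    generalize (proj1 (Rabs_le_between _ _) (HV n Hn)). lra.
  - set (q := Rmin r (1 / 4)). assert (Hq : 0 < q) by (apply Rmin_glb_lt; lra).
    assert (Hq1 : q <= r) by apply Rmin_l. assert (Hq2 : q <= 1 / 4) by apply Rmin_r.
    (* [floor_index] rounds down, so the node of [t] may be farther from 1 than [t] by one mesh
       width; [q / 2] is reserved for each. *)
    exists (q / 2). split; [lra |]. intros t Ht.
    apply (tends_le G HG _ _ _ _ (U_tends t ltac:(lra)) (tends_const G HG e)).
    apply (ultra_mono _ HG _ _ (ultra_and _ HG _ _ (ultra_ge _ HG n0)
      (ultra_and _ HG _ _ (ultra_ge _ HG 1%nat) (ultra_mesh (q / 2) ltac:(lra))))).
    intros n [Hn [Hn1 Hm]].
    assert (Hle := floor_index_le n t ltac:(lra)). assert (HK := mesh_pos n).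
    destruct (floor_index_div n t ltac:(lra)) as [Hf1 Hf2].
    assert (Hdiv : INR (2 * n + 1 - floor_index n t) / INR (2 * n + 1) <= q).
    { rewrite minus_INR by exact Hle. unfold Rdiv in *.
      rewrite Rmult_minus_distr_r, Rinv_r by lra. lra. }
    replace (floor_index n t) with (2 * n + 1 - (2 * n + 1 - floor_index n t))%nat by lia.
    apply Hsmall; [exact Hn | | lra].
    apply (Rle_div_l _ _ _ HK) in Hdiv. apply INR_le.
    rewrite INR_odd in Hdiv. apply le_INR in Hn1. simpl in Hn1. nra.
Qed.

Lemma U_lim_0 : U_lim 0 = 0.
Proof.
  apply Rle_antisym; [| apply U_lim_ge0; lra].
  apply Rnot_lt_le. intros H. destruct (U_lim_at_0 (U_lim 0 / 2) ltac:(lra)) as [r [Hr Hs]].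
  generalize (Hs 0 ltac:(lra)). lra.
Qed.

Lemma U_lim_1 : U_lim 1 = 0.
Proof.
  apply Rle_antisym; [| apply U_lim_ge0; lra].
  apply Rnot_lt_le. intros H. destruct (U_lim_at_1 (U_lim 1 / 2) ltac:(lra)) as [r [Hr Hs]].
  generalize (Hs 1 ltac:(lra)). lra.
Qed.

Lemma U_lim_cont_on : cont_on (fun t => 0 <= t <= 1) U_lim.
Proof.
  intros x Hx e He. simpl. unfold R_dist.
  destruct (Req_dec x 0) as [-> | H0]; [| destruct (Req_dec x 1) as [-> | H1]].
  - destruct (U_lim_at_0 (e / 2) ltac:(lra)) as [r [Hr Hs]]. exists r. split; [exact Hr |].
    intros y [Hy Hyr]. rewrite U_lim_0. apply Rabs_def2 in Hyr.
    generalize (U_lim_ge0 y Hy) (Hs y ltac:(lra)). intros. apply Rabs_def1; lra.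
  - destruct (U_lim_at_1 (e / 2) ltac:(lra)) as [r [Hr Hs]]. exists r. split; [exact Hr |].
    intros y [Hy Hyr]. rewrite U_lim_1. apply Rabs_def2 in Hyr.
    generalize (U_lim_ge0 y Hy) (Hs y ltac:(lra)). intros. apply Rabs_def1; lra.
  - assert (Hc : continuity_pt U_lim x).
    { apply derivable_continuous_pt. exists (g x (V_lim x)). apply U_lim_derivable. lra. }
    destruct (Hc e He) as [r [Hr Hs]]. exists r. split; [exact Hr |].
    intros y [Hy Hyr]. destruct (Req_dec y x) as [-> | Hne]; [rewrite Rminus_diag, Rabs_R0; exact He |].
    apply (Hs y). split; [split; [exact I | auto] | exact Hyr].
Qed.

Lemma shooting_limit : exists u v : R -> R,
  cont_on (fun t => 0 <= t <= 1) u /\ u 0 = 0 /\ u 1 = 0 /\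
  (forall t, 0 < t < 1 -> derivable_pt_lim u t (g t (v t))) /\
  (forall t, 0 < t < 1 -> derivable_pt_lim v t (- (lam * h t * F (u t)))) /\
  (forall t, 0 <= t <= 1 -> 0 <= u t) /\
  (forall y t, 0 <= t <= 1 -> (forall n, (n0 <= n)%nat -> smax (2 * n + 1) (s n) <= y) -> u t <= y) /\
  (forall y t a, 0 < a -> a < t -> a < 1 - t ->
     (forall n, (n0 <= n)%nat -> y <= smax (2 * n + 1) (s n)) -> y <= (1 + K0 / a) * u t).
Proof.
  exists U_lim, V_lim.
  repeat match goal with |- _ /\ _ => split end.
  - apply U_lim_cont_on.
  - apply U_lim_0.
  - apply U_lim_1.
  - apply U_lim_derivable.
  - apply V_lim_derivable.
  - apply U_lim_ge0.
  - intros y t Ht Hy. apply U_lim_le; assumption.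
  - intros y t a Ha H1 H2 Hy. apply U_lim_lower; assumption.
Qed.

End Limit.

End Shooting.

(** * The boundary value problem *)

Lemma odd_inc_homeo_inverse phi : odd_inc_homeo phi -> exists phii : R -> R,
  (forall y, phi (phii y) = y) /\ (forall x, phii (phi x) = x) /\
  (forall x y, x <= y -> phii x <= phii y) /\ (forall x, phii (- x) = - phii x) /\
  continuity phii.
Proof.
  intros [Hodd [Hinc [_ Hsurj]]].
  destruct (choice (fun y x => phi x = y) Hsurj) as [phii Hphii]. exists phii.
  assert (Hinj : forall x y, phi x = phi y -> x = y).
  { intros x y H. destruct (Rtotal_order x y) as [Hl | [He | Hg]]; [| exact He |].
    - generalize (Hinc _ _ Hl). lra.
    - generalize (Hinc _ _ Hg). lra. }
  assert (Hlt : forall x y, phii x < y -> x < phi y).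
  { intros x y H. rewrite <- (Hphii x). auto. }
  assert (Hgt : forall x y, y < phii x -> phi y < x).
  { intros x y H. rewrite <- (Hphii x). auto. }
  assert (Hlt' : forall x y, x < phi y -> phii x < y).
  { intros x y H. rewrite <- (Hphii x) in H. apply Rnot_le_lt. intros [Hc | Hc].
    - generalize (Hinc _ _ Hc). lra.
    - rewrite Hc in H. lra. }
  assert (Hgt' : forall x y, phi y < x -> y < phii x).
  { intros x y H. rewrite <- (Hphii x) in H. apply Rnot_le_lt. intros [Hc | Hc].
    - generalize (Hinc _ _ Hc). lra.
    - rewrite Hc in H. lra. }
  repeat split.
  - exact Hphii.
  - intros x. apply Hinj, Hphii.
  - intros x y Hxy. apply Rnot_lt_le. intros H. apply Hinc in H. rewrite !Hphii in H. lra.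
  - intros x. apply Hinj. rewrite Hodd, !Hphii. reflexivity.
  - intros y e He.
    assert (H1 := Hlt y (phii y + e) ltac:(lra)). assert (H2 := Hgt y (phii y - e) ltac:(lra)).
    exists (Rmin (phi (phii y + e) - y) (y - phi (phii y - e))).
    split; [apply Rmin_glb_lt; lra |]. intros x [_ Hx]. simpl in *. unfold R_dist in *.
    apply Rabs_def2 in Hx.
    generalize (Rmin_l (phi (phii y + e) - y) (y - phi (phii y - e)))
      (Rmin_r (phi (phii y + e) - y) (y - phi (phii y - e))). intros.
    generalize (Hlt' x (phii y + e) ltac:(lra)) (Hgt' x (phii y - e) ltac:(lra)). intros.
    apply Rabs_def1; lra.
Qed.

Lemma cont_on_retract (D : R -> Prop) (f r : R -> R) : cont_on D f -> (forall x, D (r x)) ->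
  (forall x y, Rabs (r x - r y) <= Rabs (x - y)) -> continuity (fun x => f (r x)).
Proof.
  intros Hf HD Hr x e He. destruct (Hf (r x) (HD x) e He) as [a [Ha H]].
  exists a. split; [exact Ha |]. intros y [_ Hy]. apply H. split; [apply HD |].
  simpl in *. unfold R_dist in *. generalize (Hr y x). lra.
Qed.

Lemma cont_on_pos_bounds (c : R -> R) : cont_on (fun t => 0 <= t <= 1) c ->
  (forall t, 0 <= t <= 1 -> 0 < c t) ->
  exists c0 c1, 0 < c0 /\ forall t, 0 <= t <= 1 -> c0 <= c t <= c1.
Proof.
  intros Hc Hp. set (r := fun t => Rmax 0 (Rmin 1 t)).
  assert (Hrid : forall t, 0 <= t <= 1 -> r t = t).
  { intros t Ht. unfold r. rewrite Rmin_right, Rmax_right by lra. reflexivity. }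
  assert (Hcc : continuity (fun t => c (r t))).
  { apply (cont_on_retract _ _ r Hc).
    - intros x. unfold r, Rmax, Rmin. destruct (Rle_dec 1 x); destruct (Rle_dec 0 _); lra.
    - intros x y. unfold r, Rmax, Rmin.
      destruct (Rle_dec 1 x), (Rle_dec 1 y); repeat destruct (Rle_dec 0 _); unfold Rabs;
        repeat destruct Rcase_abs; lra. }
  destruct (continuity_ab_min (fun t => c (r t)) 0 1 ltac:(lra) (fun x _ => Hcc x)) as [m [Hm Hm1]].
  destruct (continuity_ab_maj (fun t => c (r t)) 0 1 ltac:(lra) (fun x _ => Hcc x)) as [M [HM HM1]].
  exists (c (r m)), (c (r M)). split; [apply Hp; rewrite Hrid; lra |].
  intros t Ht. generalize (Hm t Ht) (HM t Ht). rewrite (Hrid t Ht). auto.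
Qed.

(** [sup_of] falls back to 0 when there is no least upper bound, so [u] must be shown bounded before
    [sup_norm u] is a supremum. *)
Lemma sup_norm_spec (u : R -> R) (b : R) : (forall t, 0 <= t <= 1 -> Rabs (u t) <= b) ->
  is_lub (fun y => exists t, 0 <= t <= 1 /\ y = Rabs (u t)) (sup_norm u).
Proof.
  intros Hb. unfold sup_norm, sup_of.
  destruct (excluded_middle_informative _) as [E | E].
  - apply (proj2_sig (constructive_indefinite_description _ E)).
  - exfalso. apply E. destruct (completeness (fun y => exists t, 0 <= t <= 1 /\ y = Rabs (u t))) as [m Hm].
    + exists b. intros y [t [Ht ->]]. auto.
    + exists (Rabs (u 0)), 0. split; [lra | reflexivity].
    + exists m. exact Hm.
Qed.

(** * Slope functions and the use of condition (A) *)

Section Problem.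

Context (phi psi1 psi2 psi1inv c d f h phii : R -> R) (c0 c1 d0 d1 : R).
Context (phi_odd : forall x, phi (- x) = - phi x).
Context (phi_incr : forall x y, x < y -> phi x < phi y).
Context (phi_phii : forall y, phi (phii y) = y) (phii_phi : forall x, phii (phi x) = x).
Context (phii_mono : forall x y, x <= y -> phii x <= phii y).
Context (phii_odd : forall x, phii (- x) = - phii x) (phii_cont : continuity phii).
Context (psi1_0 : 0 <= psi1 0) (psi1_incr : forall x y, 0 <= x -> x < y -> psi1 x < psi1 y).
Context (psi1_surj : forall y, 0 <= y -> exists x, 0 <= x /\ psi1 x = y).
Context (psi2_ge0 : forall x, 0 <= x -> 0 <= psi2 x).
Context (phi_condA : condA phi psi1 psi2).
Context (psi1inv_spec : forall y, 0 <= y -> 0 <= psi1inv y /\ psi1 (psi1inv y) = y).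
Context (c0_pos : 0 < c0) (c_bounds : forall t, 0 < t < 1 -> c0 <= c t <= c1).
Context (d0_pos : 0 < d0) (d_bounds : forall t, 0 < t < 1 -> d0 <= d t <= d1).
Context (c_cont : forall t, 0 < t < 1 -> continuity_pt c t).
Context (d_cont : forall t, 0 < t < 1 -> continuity_pt d t).
Context (f_cont : cont_on (fun s => 0 <= s) f) (f_ge0 : forall s, 0 <= s -> 0 <= f s).
Context (h_cont : forall t, 0 < t < 1 -> continuity_pt h t).
Context (h_ge0 : forall t, 0 < t < 1 -> 0 <= h t).
Context (left_sums : half_sums_controlled h psi1inv).
Context (right_sums : half_sums_controlled (fun t => h (1 - t)) psi1inv).

(** The derivative u' in terms of the flux [x] = d phi(c u'). The two bounds below put the extreme
    values of [d] and [c] in place of their values at [t]. *)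
Definition slope (t x : R) : R := phii (x * / d t) * / c t.
Definition slope_low (x : R) : R := phii (x * / d1) * / c1.
Definition slope_up (x : R) : R := phii (x * / d0) * / c0.
(** Shot trajectories may become negative, where nothing is assumed about [f]; the constant
    extension by [f 0] is continuous and nonnegative. *)
Definition f_ext (x : R) : R := f (Rmax 0 x).

Lemma phi_0 : phi 0 = 0.
Proof. generalize (phi_odd 0). rewrite Ropp_0. lra. Qed.

Lemma phii_0 : phii 0 = 0.
Proof. rewrite <- phi_0 at 1. apply phii_phi. Qed.

Lemma phii_ge0 x : 0 <= x -> 0 <= phii x.
Proof. intros H. rewrite <- phii_0. apply phii_mono, H. Qed.

Lemma phi_mono x y : x <= y -> phi x <= phi y.
Proof. intros [H | ->]; [apply Rlt_le, phi_incr, H | lra]. Qed.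

Lemma phi_pos x : 0 < x -> 0 < phi x.
Proof. intros H. rewrite <- phi_0. apply phi_incr, H. Qed.

Lemma lt_phii x y : phi x < y -> x < phii y.
Proof.
  intros H. apply Rnot_le_lt. intros Hc. apply phi_mono in Hc. rewrite phi_phii in Hc. lra.
Qed.

Lemma phii_lt x y : y < phi x -> phii y < x.
Proof.
  intros H. apply Rnot_le_lt. intros Hc. apply phi_mono in Hc. rewrite phi_phii in Hc. lra.
Qed.

Lemma phii_le x y : y <= phi x -> phii y <= x.
Proof. intros H. rewrite <- (phii_phi x). apply phii_mono, H. Qed.

Lemma phii_pos x : 0 < x -> 0 < phii x.
Proof. intros H. apply lt_phii. rewrite phi_0. exact H. Qed.

Lemma c0_le_c1 : c0 <= c1.
Proof. destruct (c_bounds (1 / 2) ltac:(lra)). lra. Qed.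

Lemma d0_le_d1 : d0 <= d1.
Proof. destruct (d_bounds (1 / 2) ltac:(lra)). lra. Qed.

Lemma scaled_phii_mono a a' b b' x : 0 < a' <= a -> 0 < b' <= b -> 0 <= x ->
  phii (x * / a) * / b <= phii (x * / a') * / b'.
Proof.
  intros Ha Hb Hx.
  apply Rmult_le_compat.
  - apply phii_ge0, Rmult_le_pos; [exact Hx | apply Rlt_le, Rinv_0_lt_compat; lra].
  - apply Rlt_le, Rinv_0_lt_compat. lra.
  - apply phii_mono, Rmult_le_compat_l; [exact Hx | apply Rinv_le_contravar; lra].
  - apply Rinv_le_contravar; lra.
Qed.

Lemma slope_low_mono x y : 0 <= x <= y -> slope_low x <= slope_low y.
Proof.
  intros H. generalize c0_le_c1 d0_le_d1. intros. unfold slope_low.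
  apply Rmult_le_compat_r; [apply Rlt_le, Rinv_0_lt_compat; lra |].
  apply phii_mono, Rmult_le_compat_r; [apply Rlt_le, Rinv_0_lt_compat |]; lra.
Qed.

Lemma slope_up_mono x y : 0 <= x <= y -> slope_up x <= slope_up y.
Proof.
  intros H. unfold slope_up.
  apply Rmult_le_compat_r; [apply Rlt_le, Rinv_0_lt_compat; lra |].
  apply phii_mono, Rmult_le_compat_r; [apply Rlt_le, Rinv_0_lt_compat |]; lra.
Qed.

Lemma slope_low_pos x : 0 < x -> 0 < slope_low x.
Proof.
  intros H. generalize c0_le_c1 d0_le_d1. intros. unfold slope_low.
  apply Rmult_lt_0_compat; [apply phii_pos, Rmult_lt_0_compat |]; try apply Rinv_0_lt_compat; lra.
Qed.

Lemma slope_low_0 : slope_low 0 = 0.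
Proof. unfold slope_low. rewrite Rmult_0_l, phii_0. ring. Qed.

Lemma slope_up_0 : slope_up 0 = 0.
Proof. unfold slope_up. rewrite Rmult_0_l, phii_0. ring. Qed.

Lemma slope_low_large y : exists x, 0 < x /\ y < slope_low x.
Proof.
  generalize c0_le_c1 d0_le_d1 (Rle_abs y) (Rabs_pos y). intros.
  exists (d1 * phi (c1 * (Rabs y + 1))). split.
  - apply Rmult_lt_0_compat; [lra | apply phi_pos, Rmult_lt_0_compat; lra].
  - unfold slope_low.
    replace (d1 * phi (c1 * (Rabs y + 1)) * / d1) with (phi (c1 * (Rabs y + 1))) by (field; lra).
    rewrite phii_phi. replace (c1 * (Rabs y + 1) * / c1) with (Rabs y + 1) by (field; lra). lra.
Qed.

(** With [psi1 k = d1 / d0], the lower half of condition (A) at z = phii(x/d1) gives phi(z k) >=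
    x/d0, that is phii(x/d0) <= k phii(x/d1); the factor c1/c0 accounts for [c]. *)
Lemma slope_comparison : exists K0, 0 <= K0 /\ forall x, 0 <= x -> slope_up x <= K0 * slope_low x.
Proof.
  generalize c0_le_c1 d0_le_d1. intros Hc Hd.
  destruct (psi1_surj (d1 / d0)) as [k [Hk Hpsi]]; [apply Rdiv_le_0_compat; lra |].
  exists (k * (c1 / c0)). split.
  - apply Rmult_le_pos; [exact Hk | apply Rdiv_le_0_compat; lra].
  - intros x Hx. unfold slope_up, slope_low.
    assert (Hq : 0 <= phii (x * / d1)).
    { apply phii_ge0, Rmult_le_pos; [exact Hx | apply Rlt_le, Rinv_0_lt_compat; lra]. }
    assert (Hle : phii (x * / d0) <= phii (x * / d1) * k).
    { apply phii_le. destruct (phi_condA (phii (x * / d1)) k Hq Hk) as [H _].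
      rewrite phi_phii, Hpsi in H.
      replace (x * / d1 * (d1 / d0)) with (x * / d0) in H by (field; lra). exact H. }
    replace (k * (c1 / c0) * (phii (x * / d1) * / c1)) with (phii (x * / d1) * k * / c0) by (field; lra).
    apply Rmult_le_compat_r; [apply Rlt_le, Rinv_0_lt_compat; lra | exact Hle].
Qed.

(** A sum is at most twice its larger summand, whence the factors 2. When [k * y] is the larger, the
    lower half of condition (A) at [psi1inv y] pulls [y] out of [phii]; this is how [psi1inv] of the
    tail masses enters the estimates. *)
Lemma slope_up_split k A y : 0 <= k -> 0 <= A -> 0 <= y ->
  slope_up (A + k * y) <= slope_up (2 * A) + slope_up (2 * k) * psi1inv y.
Proof.
  intros Hk HA Hy. destruct (psi1inv_spec y Hy) as [Hp0 Hp].
  assert (Hge : forall x, 0 <= x -> 0 <= slope_up x).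
  { intros x Hx. rewrite <- slope_up_0. apply slope_up_mono. lra. }
  assert (Hky : 0 <= k * y) by (apply Rmult_le_pos; assumption).
  destruct (Rle_lt_dec (k * y) A) as [H | H].
  - generalize (slope_up_mono (A + k * y) (2 * A) ltac:(lra))
      (Rmult_le_pos _ _ (Hge (2 * k) ltac:(lra)) Hp0). lra.
  - apply Rle_trans with (slope_up (2 * k * y)); [apply slope_up_mono; lra |].
    assert (Hle : slope_up (2 * k * y) <= slope_up (2 * k) * psi1inv y).
    { unfold slope_up. rewrite (Rmult_comm _ (psi1inv y)), <- Rmult_assoc.
      apply Rmult_le_compat_r; [apply Rlt_le, Rinv_0_lt_compat, c0_pos |].
      rewrite (Rmult_comm (psi1inv y)). apply phii_le.
      assert (Hz : 0 <= phii (2 * k * / d0)).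
      { apply phii_ge0, Rmult_le_pos; [lra | apply Rlt_le, Rinv_0_lt_compat, d0_pos]. }
      destruct (phi_condA _ _ Hz Hp0) as [Ha _]. rewrite phi_phii, Hp in Ha. lra. }
    generalize (Hge (2 * A) ltac:(lra)). lra.
Qed.

Lemma slope_bound t x : 0 < t < 1 -> 0 <= x -> slope_low x <= slope t x <= slope_up x.
Proof.
  intros Ht Hx. destruct (c_bounds t Ht), (d_bounds t Ht).
  split; apply scaled_phii_mono; lra.
Qed.

Lemma slope_odd t x : slope t (- x) = - slope t x.
Proof. unfold slope. rewrite Ropp_mult_distr_l_reverse, phii_odd. ring. Qed.

Lemma slope_joint t x e : 0 < t < 1 -> 0 < e -> exists r, 0 < r /\
  forall t' x', 0 < t' < 1 -> Rabs (t' - t) < r -> Rabs (x' - x) < r ->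
    Rabs (slope t' x' - slope t x) < e.
Proof.
  intros Ht He.
  assert (Hinv : forall w w0, 0 < w0 -> (forall t, 0 < t < 1 -> w0 <= w t) ->
    (forall t, 0 < t < 1 -> continuity_pt w t) -> continuity_2d_pt (fun u _ : R => / w u) t x).
  { intros w w0 Hw0 Hw Hc. apply continuity_2d_pt_inv; [| generalize (Hw t Ht); lra].
    apply (continuity_1d_2d_pt_comp w (fun u _ => u)); [apply Hc, Ht | apply continuity_2d_pt_id1]. }
  assert (H : continuity_2d_pt slope t x).
  { unfold slope. apply continuity_2d_pt_mult.
    - apply (continuity_1d_2d_pt_comp phii (fun u v => v * / d u)); [apply phii_cont |].
      apply continuity_2d_pt_mult; [apply continuity_2d_pt_id2 |].
      apply (Hinv d d0 d0_pos (fun z Hz => proj1 (d_bounds z Hz)) d_cont).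
    - apply (Hinv c c0 c0_pos (fun z Hz => proj1 (c_bounds z Hz)) c_cont). }
  destruct (H (mkposreal e He)) as [r Hr]. exists r. split; [apply cond_pos |].
  intros t' x' _ H1 H2. apply Hr; assumption.
Qed.

Lemma slope_cont t : 0 < t < 1 -> continuity (slope t).
Proof.
  intros Ht x e He. destruct (slope_joint t x e Ht He) as [r [Hr H]]. exists r. split; [exact Hr |].
  intros y [_ Hy]. apply H; auto. rewrite Rminus_diag, Rabs_R0. exact Hr.
Qed.

Lemma f_ext_cont : continuity f_ext.
Proof.
  apply (cont_on_retract _ f (Rmax 0) f_cont); [intros; apply Rmax_l |].
  intros x y. unfold Rmax. destruct (Rle_dec 0 x), (Rle_dec 0 y); unfold Rabs;
    repeat destruct Rcase_abs; lra.
Qed.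

Lemma f_ext_ge0 x : 0 <= f_ext x.
Proof. apply f_ge0, Rmax_l. Qed.

Lemma f_ext_pos x : 0 <= x -> f_ext x = f x.
Proof. intros H. unfold f_ext. rewrite Rmax_right by exact H. reflexivity. Qed.

Lemma f_ext_bounded M : exists B, 0 < B /\ forall x, x <= M -> f_ext x <= B.
Proof.
  destruct (continuity_ab_maj f_ext 0 (Rmax 0 M) (Rmax_l _ _) (fun x _ => f_ext_cont x)) as [m [Hm _]].
  exists (f_ext m + 1). split; [generalize (f_ext_ge0 m); lra |].
  intros x Hx. apply Rle_trans with (f_ext m); [| lra].
  replace (f_ext x) with (f_ext (Rmax 0 x)) by (unfold f_ext; rewrite (Rmax_right 0 (Rmax 0 x)); auto using Rmax_l).
  apply Hm. split; [apply Rmax_l |]. apply Rle_max_compat_l, Hx.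
Qed.

(** With u' = [slope t (v t)] the expression d phi(c u') collapses to [v], but only on (0,1), so its
    derivative is obtained from that of [v] by local equality. *)
Lemma solution_of_system lam u v : cont_on (fun t => 0 <= t <= 1) u -> u 0 = 0 -> u 1 = 0 ->
  (forall t, 0 < t < 1 -> derivable_pt_lim u t (slope t (v t))) ->
  (forall t, 0 < t < 1 -> derivable_pt_lim v t (- (lam * h t * f_ext (u t)))) ->
  (forall t, 0 < t < 1 -> 0 < u t) -> is_pos_solution phi c d h f lam u.
Proof.
  intros Hu H0 H1 Hdu Hdv Hpos. split; [| exact Hpos]. split; [exact Hu |].
  assert (Hcu : forall t, 0 < t < 1 -> continuity_pt u t).
  { intros t Ht. apply derivable_continuous_pt. eexists. apply Hdu, Ht. }
  assert (Hcv : forall t, 0 < t < 1 -> continuity_pt v t).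
  { intros t Ht. apply derivable_continuous_pt. eexists. apply Hdv, Ht. }
  exists (fun t => slope t (v t)). split; [exact Hdu |]. split.
  - intros t Ht e He. destruct (slope_joint t (v t) e Ht He) as [r [Hr Hs]].
    destruct (Hcv t Ht r Hr) as [r' [Hr' Hv']].
    assert (Hp : 0 < Rmin t (1 - t)) by (apply Rmin_glb_lt; lra).
    set (q := Rmin (Rmin r r') (Rmin t (1 - t))).
    assert (Hq : 0 < q) by (repeat apply Rmin_glb_lt; lra).
    assert (Hq1 : q <= r) by (apply Rle_trans with (1 := Rmin_l _ _), Rmin_l).
    assert (Hq2 : q <= r') by (apply Rle_trans with (1 := Rmin_l _ _), Rmin_r).
    assert (Hq3 : q <= t) by (apply Rle_trans with (1 := Rmin_r _ _), Rmin_l).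
    assert (Hq4 : q <= 1 - t) by (apply Rle_trans with (1 := Rmin_r _ _), Rmin_r).
    exists q. split; [exact Hq |]. intros x [[_ Hne] Hx]. simpl in *. unfold R_dist in *.
    apply Hs; [apply Rabs_def2 in Hx; lra | lra |].
    apply (Hv' x). split; [split; [exact I | exact Hne] | lra].
  - exists (fun t => - (lam * h t * f_ext (u t))). repeat split; auto.
    + intros t Ht. apply is_derive_Reals.
      assert (Hp : 0 < Rmin t (1 - t)) by (apply Rmin_glb_lt; lra).
      apply (is_derive_ext_loc v); [| apply is_derive_Reals, Hdv, Ht].
      exists (mkposreal _ Hp). intros y Hy. unfold ball in Hy; simpl in Hy.
      unfold AbsRing_ball, abs, minus, plus, opp in Hy; simpl in Hy. apply Rabs_def2 in Hy.
      generalize (Rmin_l t (1 - t)) (Rmin_r t (1 - t)). intros.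
      assert (Hy' : 0 < y < 1) by lra.
      destruct (c_bounds y Hy'), (d_bounds y Hy'). unfold slope.
      replace (c y * (phii (v y * / d y) * / c y)) with (phii (v y * / d y)) by (field; lra).
      rewrite phi_phii. change (@eq R (v y) (d y * (v y * / d y))). field. lra.
    + intros t Ht. apply continuity_pt_opp.
      apply (continuity_pt_mult (fun t => lam * h t) (fun t => f_ext (u t))).
      * apply (continuity_pt_scal h), h_cont, Ht.
      * apply (continuity_pt_comp u f_ext); [apply Hcu, Ht | apply f_ext_cont].
    + intros t Ht. rewrite f_ext_pos by (apply Rlt_le, Hpos, Ht). ring.
Qed.

(** [M] does not depend on [rho], so the same size of f/phi forces overshooting at small and at
    large levels. The upper half of condition (A) at y = c1/(a0 kap) gives phi(kap rho y) <= phi(kap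
    rho) psi2(y), where kap rho y = rho c1/a0; the [+ 1] makes it strict, and the rest of [M]
    cancels the factors inside [slope_low]. *)
Lemma overshoot_scale lam kap a b a0 h0 : 0 < lam -> 0 < kap -> a < b -> 0 < a0 -> 0 < h0 ->
  exists M, 0 <= M /\ forall rho, 0 < rho -> 
    rho < a0 * slope_low ((b - a) * (lam * (M * phi (kap * rho)) * h0) / 4).
Proof.
  intros Hlam Hkap Hab Ha0 Hh0. generalize c0_le_c1 d0_le_d1. intros Hc Hd.
  set (y := c1 / (a0 * kap)).
  assert (Hy : 0 < y) by (apply Rdiv_lt_0_compat; [lra | apply Rmult_lt_0_compat; lra]).
  assert (Hpsi := psi2_ge0 y (Rlt_le _ _ Hy)).
  assert (Hden : 0 < (b - a) * lam * h0) by (repeat apply Rmult_lt_0_compat; lra).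
  exists ((psi2 y + 1) * (4 * d1) / ((b - a) * lam * h0)). split.
  - apply Rdiv_le_0_compat; [apply Rmult_le_pos; lra | exact Hden].
  - intros rho Hrho. assert (Hkr : 0 < kap * rho) by (apply Rmult_lt_0_compat; lra).
    assert (Hphi := phi_pos _ Hkr). unfold slope_low.
    match goal with |- _ < a0 * (phii ?z * _) => replace z with ((psi2 y + 1) * phi (kap * rho)) end.
    2: { field. repeat split; try lra. }
    destruct (phi_condA (kap * rho) y ltac:(lra) ltac:(lra)) as [_ H].
    assert (Hlt : kap * rho * y < phii ((psi2 y + 1) * phi (kap * rho))) by (apply lt_phii; lra).
    assert (Heq : kap * rho * y = rho * c1 * / a0) by (unfold y; field; lra).
    rewrite Heq in Hlt.
    apply (Rmult_lt_compat_r (a0 * / c1)) in Hlt.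
    + replace (rho * c1 * / a0 * (a0 * / c1)) with rho in Hlt by (field; lra). lra.
    + apply Rmult_lt_0_compat; [exact Ha0 | apply Rinv_0_lt_compat; lra].
Qed.

(** * Discrete roots, their limits and the choice of the parameter range *)

Section Solutions.

Context (K0 : R) (K0_ge0 : 0 <= K0).
Context (slope_cmp : forall x, 0 <= x -> slope_up x <= K0 * slope_low x).
Context (M : R) (M_pos : 0 < M).
Context (left_M : forall n m, (m <= n)%nat -> half_sum h psi1inv n m <= M).
Context (right_M : forall n m, (m <= n)%nat -> half_sum (fun t => h (1 - t)) psi1inv n m <= M).

(** The lower bound [rmin] keeps the limit from being trivial: the Harnack inequality turns it into
    positivity at every interior point. *)
Lemma root_family_limit lam rmin rmax (n0 : nat) (s : nat -> R) : 0 < lam -> 0 < rmin -> 0 < rmax ->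
  (forall n, (n0 <= n)%nat ->
     su h slope f_ext lam (2 * n + 1) (s n) (2 * n + 1) = 0 /\
     rmin <= smax h slope f_ext lam (2 * n + 1) (s n) <= rmax) ->
  exists u, is_pos_solution phi c d h f lam u /\
    (forall y, (forall n, (n0 <= n)%nat -> smax h slope f_ext lam (2 * n + 1) (s n) <= y) ->
       sup_norm u <= y) /\
    (forall y t a, 0 < a -> a < t -> a < 1 - t ->
       (forall n, (n0 <= n)%nat -> y <= smax h slope f_ext lam (2 * n + 1) (s n)) ->
       y <= (1 + K0 / a) * sup_norm u) /\ 0 < sup_norm u.
Proof.
  intros Hlam Hrmin Hrmax Hs.
  destruct (nonprincipal_ultrafilter_ex) as [G HG].
  destruct (f_ext_bounded rmax) as [B [HB HfB]].
  assert (HlB : 0 <= lam * B) by (apply Rmult_le_pos; lra).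
  assert (HCk : 0 <= slope_up (2 * (lam * B))).
  { rewrite <- slope_up_0. apply slope_up_mono. lra. }
  destruct (shooting_limit slope_low slope_up K0 slope_low_mono slope_up_mono slope_low_0
    slope_up_0 K0_ge0 slope_cmp slope_low_large h h_cont h_ge0 slope f_ext lam slope_bound slope_odd
    f_ext_cont f_ext_ge0 Hlam G HG s n0 rmax Hrmax
    (fun n Hn => proj1 (Hs n Hn)) (fun n Hn => proj2 (proj2 (Hs n Hn)))
    slope_joint psi1inv (fun y Hy => proj1 (psi1inv_spec y Hy)) left_sums right_sums
    B (slope_up (2 * (lam * B))) HB HCk HfB (fun A y HA Hy => slope_up_split (lam * B) A y HlB HA Hy))
    as [u [v [Hu [Hu0 [Hu1 [Hdu [Hdv [Hge [Hup Hlow]]]]]]]]].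
  assert (Hpos : forall t, 0 < t < 1 -> 0 < u t).
  { intros t Ht. destruct (interior_margin t Ht) as [a [Ha [H1 [H2 _]]]].
    generalize (Hlow rmin t a Ha H1 H2 (fun n Hn => proj1 (proj2 (Hs n Hn)))).
    generalize (Rdiv_le_0_compat _ _ K0_ge0 Ha). intros. apply Rnot_le_lt. intros Hc. nra. }
  assert (Hlub := sup_norm_spec u rmax ltac:(intros t Ht; rewrite Rabs_right by (apply Rle_ge, Hge, Ht);
    apply (Hup rmax t Ht (fun n Hn => proj2 (proj2 (Hs n Hn)))))).
  destruct Hlub as [Hub Hleast].
  assert (Hut : forall t, 0 <= t <= 1 -> u t <= sup_norm u).
  { intros t Ht. apply Hub. exists t. split; [exact Ht |].
    rewrite Rabs_right; [reflexivity | apply Rle_ge, Hge, Ht]. }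
  exists u. split; [apply (solution_of_system lam u v); assumption |]. split; [| split].
  - intros y Hy. apply Hleast. intros z [t [Ht ->]].
    rewrite Rabs_right by (apply Rle_ge, Hge, Ht). apply (Hup y t Ht Hy).
  - intros y t a Ha H1 H2 Hy. apply Rle_trans with (1 := Hlow y t a Ha H1 H2 Hy).
    apply Rmult_le_compat_l; [generalize (Rdiv_le_0_compat _ _ K0_ge0 Ha); lra | apply Hut; lra].
  - generalize (Hpos (1 / 2) ltac:(lra)) (Hut (1 / 2) ltac:(lra)). lra.
Qed.

Context (a b h0 : R) (ab : 0 < a < b) (b_lt1 : b < 1) (h0_pos : 0 < h0).
Context (h_low : forall t, a <= t <= b -> h0 <= h t).
Context (f0_inf : f0_infinite f phi) (finf_inf : finf_infinite f phi).

(** [W] is the Harnack factor for points at distance [a0] from both ends. [Cst] makes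
    [Cst * phii (2 * (lam * B) * / d0)] equal to [slope_up (2 * (lam * B)) * M], the bound given by
    [shoot_peak]. *)
Let a0 := Rmin a (1 - b).
Let W := 1 + K0 / a0.
Let Cst := M * / c0.

Lemma W_ge1 : 1 <= W.
Proof.
  assert (0 < a0) by (apply Rmin_glb_lt; lra).
  unfold W. generalize (Rdiv_le_0_compat _ _ K0_ge0 H). lra.
Qed.

Lemma overshoot_of_ratio lam rho Mq n s : 0 < lam -> 0 < rho -> 0 <= Mq ->
  rho < a0 * slope_low ((b - a) * (lam * (Mq * phi (/ W * rho)) * h0) / 4) ->
  (forall x, / W * rho <= x <= rho -> Mq < f x / phi x) ->
  6 <= (b - a) * INR n -> smax h slope f_ext lam n s = rho ->
  su h slope f_ext lam n s n < 0.
Proof.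
  intros Hlam Hrho HMq Hscale Hf Hn Hmax.
  assert (Ha0 : 0 < a0) by (apply Rmin_glb_lt; lra).
  assert (HW := W_ge1). assert (HWi : 0 < / W) by (apply Rinv_0_lt_compat; lra).
  assert (HWr : 0 < / W * rho) by (apply Rmult_lt_0_compat; lra).
  assert (Hphi := phi_pos _ HWr).
  apply (shoot_overshoot slope_low slope_up K0 slope_low_mono slope_up_mono slope_low_0
    slope_up_0 K0_ge0 slope_cmp h h_cont h_ge0 slope f_ext lam slope_bound slope_odd
    f_ext_ge0 Hlam n s a b a0 h0 rho (Mq * phi (/ W * rho))); auto; try lra.
  - apply Rmin_l.
  - apply Rmin_r.
  - apply Rmult_le_pos; lra.
  - fold W. replace (rho / W) with (/ W * rho) by (unfold Rdiv; ring). intros x Hx.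
    rewrite f_ext_pos by lra. assert (Hpx : 0 < phi x) by (apply phi_pos; lra).
    specialize (Hf x Hx). apply (Rlt_div_r _ _ _ Hpx) in Hf.
    assert (phi (/ W * rho) <= phi x) by (apply phi_mono; lra). nra.
Qed.

Lemma peak_bound lam B Mf n s : 0 < lam -> 0 < B -> (forall x, x <= Mf -> f_ext x <= B) ->
  su h slope f_ext lam (2 * n + 1) s (2 * n + 1) <= 0 ->
  smax h slope f_ext lam (2 * n + 1) s <= Mf ->
  smax h slope f_ext lam (2 * n + 1) s <= Cst * phii (2 * (lam * B) * / d0).
Proof.
  intros Hlam HB HfB Hend Hmax.
  assert (HlB : 0 <= lam * B) by (apply Rmult_le_pos; lra).
  assert (HCk : 0 <= slope_up (2 * (lam * B))).
  { rewrite <- slope_up_0. apply slope_up_mono. lra. }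
  generalize (shoot_peak slope_low slope_up slope_low_mono slope_up_mono slope_low_pos slope_low_0
    slope_up_0 h h_cont h_ge0 slope f_ext lam slope_bound slope_odd f_ext_ge0 Hlam n s Mf B
    (slope_up (2 * (lam * B))) psi1inv M (fun y Hy => proj1 (psi1inv_spec y Hy))
    (Rlt_le _ _ HB) HCk HfB (fun A y HA Hy => slope_up_split (lam * B) A y HlB HA Hy)
    (left_M n) (right_M n) Hend Hmax).
  unfold slope_up, Cst. lra.
Qed.

Lemma Cst_pos : 0 < Cst.
Proof. apply Rmult_lt_0_compat; [exact M_pos | apply Rinv_0_lt_compat, c0_pos]. Qed.

Lemma small_parameter B e lam : 0 < B -> 0 < e -> 0 < lam < d0 * phi (e / Cst) / (2 * B) ->
  Cst * phii (2 * (lam * B) * / d0) < e.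
Proof.
  intros HB He [Hlam Hlt]. assert (HC := Cst_pos).
  apply Rlt_le_trans with (Cst * (e / Cst)); [| right; field; lra].
  apply Rmult_lt_compat_l; [exact HC |]. apply phii_lt.
  apply (Rlt_div_r _ _ (2 * B)) in Hlt; [| lra].
  change (2 * (lam * B) * / d0) with (2 * (lam * B) / d0).
  apply (Rlt_div_l _ _ _ d0_pos). lra.
Qed.

Lemma mesh_fine : exists n0 : nat, forall n, (n0 <= n)%nat -> 6 <= (b - a) * INR (2 * n + 1).
Proof.
  destruct (nfloor_ex (6 / (b - a))) as [N [_ HN]]; [apply Rdiv_le_0_compat; lra |].
  exists (S N). intros n Hn. apply le_INR in Hn. rewrite S_INR in Hn. rewrite INR_odd.
  apply Rlt_div_l in HN; [| lra]. generalize (pos_INR N). nra.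
Qed.

Lemma shooting_roots lam B : 0 < lam -> 0 < B -> (forall x, x <= 1 -> f_ext x <= B) ->
  Cst * phii (2 * (lam * B) * / d0) < 1 ->
  exists (n0 : nat) (r R1 : R) (s1 s2 : nat -> R), 0 < r /\ 1 < R1 /\
    forall n, (n0 <= n)%nat ->
      (su h slope f_ext lam (2 * n + 1) (s1 n) (2 * n + 1) = 0 /\
       r <= smax h slope f_ext lam (2 * n + 1) (s1 n) <= 1) /\
      (su h slope f_ext lam (2 * n + 1) (s2 n) (2 * n + 1) = 0 /\
       1 <= smax h slope f_ext lam (2 * n + 1) (s2 n) <= R1).
Proof.
  intros Hlam HB HfB Hsmall.
  assert (Ha0 : 0 < a0) by (apply Rmin_glb_lt; lra).
  assert (HW := W_ge1). assert (HWi : 0 < / W) by (apply Rinv_0_lt_compat; lra).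
  (* [Mq] depends on [lam], and through it so do the levels [r] and [R1]. *)
  destruct (overshoot_scale lam (/ W) a b a0 h0 Hlam HWi ltac:(lra) Ha0 h0_pos) as [Mq [HMq Hscale]].
  destruct (f0_inf Mq) as [del [Hdel Hf0]]. destruct (finf_inf Mq) as [S0 HfS].
  destruct mesh_fine as [n0 Hn0].
  set (r := Rmin (del / 2) (1 / 2)).
  assert (Hr : 0 < r) by (apply Rmin_glb_lt; lra).
  assert (Hr1 : r <= del / 2) by apply Rmin_l. assert (Hr2 : r <= 1 / 2) by apply Rmin_r.
  (* Even after division by the Harnack factor [R1] lies beyond [S0], so f/phi exceeds [Mq] on all
     of [R1/W, R1]; the 2 also ensures [1 < R1]. *)
  set (R1 := (Rabs S0 + 2) * W).
  assert (HS0 := Rle_abs S0). assert (HS0' := Rabs_pos S0).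
  assert (HR1 : 1 < R1) by (unfold R1; nra).
  assert (Hover_r : forall n s, (n0 <= n)%nat -> smax h slope f_ext lam (2 * n + 1) s = r ->
    su h slope f_ext lam (2 * n + 1) s (2 * n + 1) < 0).
  { intros n s Hn Hm. apply (overshoot_of_ratio lam r Mq); auto.
    intros x Hx. apply Hf0. assert (0 < / W * r) by (apply Rmult_lt_0_compat; lra). lra. }
  assert (Hover_R : forall n s, (n0 <= n)%nat -> smax h slope f_ext lam (2 * n + 1) s = R1 ->
    su h slope f_ext lam (2 * n + 1) s (2 * n + 1) < 0).
  { intros n s Hn Hm. apply (overshoot_of_ratio lam R1 Mq); auto; [lra | apply Hscale; lra |].
    intros x Hx. apply HfS. unfold R1 in Hx.
    replace (/ W * ((Rabs S0 + 2) * W)) with (Rabs S0 + 2) in Hx by (field; lra). lra. }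
  assert (Hunder : forall n s, smax h slope f_ext lam (2 * n + 1) s = 1 ->
    0 < su h slope f_ext lam (2 * n + 1) s (2 * n + 1)).
  { intros n s Hm. apply Rnot_le_lt. intros Hc.
    generalize (peak_bound lam B 1 n s Hlam HB HfB Hc ltac:(lra)). lra. }
  assert (Hcm : forall n, continuity (smax h slope f_ext lam n)).
  { intros n. apply smax_continuity; [exact slope_cont | exact f_ext_cont]. }
  assert (Hcu : forall n, continuity (fun s => su h slope f_ext lam n s n)).
  { intros n. apply shoot_continuity; [exact slope_cont | exact f_ext_cont | lia]. }
  assert (Hm0 : forall n, smax h slope f_ext lam n 0 = 0).
  { intros n. apply (smax_0 slope_low slope_up slope_low_mono slope_low_0 h h_cont h_ge0
      slope f_ext lam slope_bound slope_odd f_ext_ge0 Hlam). }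
  assert (Hlarge : forall n y, exists s, 0 < s /\ y < smax h slope f_ext lam (2 * n + 1) s).
  { intros n y. apply (smax_large slope_low slope_up slope_low_large h h_cont h_ge0
      slope f_ext lam slope_bound slope_odd f_ext_ge0 Hlam). lia. }
  assert (H1 : forall n, exists s, (n0 <= n)%nat ->
    su h slope f_ext lam (2 * n + 1) s (2 * n + 1) = 0 /\ r <= smax h slope f_ext lam (2 * n + 1) s <= 1).
  (* [choice] asks for a value at every [n]; below [n0] a dummy 0 is supplied. *)
  { intros n. destruct (Nat.le_gt_cases n0 n) as [Hn | Hn]; [| exists 0; intros; lia].
    destruct (Hlarge n 1) as [sl [Hsl Hml]].
    destruct (ivt_band (smax h slope f_ext lam (2 * n + 1))
      (fun s => su h slope f_ext lam (2 * n + 1) s (2 * n + 1)) r 1 sl) as [s [_ [Hs1 Hs2]]]; auto.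
    - lra.
    - rewrite Hm0. exact Hr.
    - exists s. auto. }
  assert (H2 : forall n, exists s, (n0 <= n)%nat ->
    su h slope f_ext lam (2 * n + 1) s (2 * n + 1) = 0 /\ 1 <= smax h slope f_ext lam (2 * n + 1) s <= R1).
  { intros n. destruct (Nat.le_gt_cases n0 n) as [Hn | Hn]; [| exists 0; intros; lia].
    destruct (Hlarge n R1) as [sl [Hsl Hml]].
    (* The sign of [su] is reversed: on this band it is positive at level 1 and negative at level
       [R1]. *)
    destruct (ivt_band (smax h slope f_ext lam (2 * n + 1))
      (fun s => - su h slope f_ext lam (2 * n + 1) s (2 * n + 1)) 1 R1 sl) as [s [_ [Hs1 Hs2]]]; auto.
    - intros s. apply (continuity_pt_opp (fun s => su h slope f_ext lam (2 * n + 1) s (2 * n + 1))), Hcu.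
    - intros s _ Hs. generalize (Hunder n s Hs). lra.
    - intros s _ Hs. generalize (Hover_R n s Hn Hs). lra.
    - rewrite Hm0. lra.
    - exists s. intros _. split; [lra | exact Hs2]. }
  destruct (choice _ H1) as [s1 Hs1]. destruct (choice _ H2) as [s2 Hs2].
  exists n0, r, R1, s1, s2. repeat split; try assumption; try (apply Hs1; assumption); apply Hs2; assumption.
Qed.

(** In the second clause [y] and [B'] are quantified after [u], so that one solution, fixed for each
    [lam], serves all levels. A root with maximum below [y * W] would by [peak_bound] have maximum
    below 1, contrary to its construction; the factor [W] is then lost in the passage to the
    limit. *)
Lemma two_solutions lam B : 0 < lam -> 0 < B -> (forall x, x <= 2 * W -> f_ext x <= B) ->
  Cst * phii (2 * (lam * B) * / d0) < 1 ->
  (exists u, is_pos_solution phi c d h f lam u /\ 0 < sup_norm u /\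
     sup_norm u <= Cst * phii (2 * (lam * B) * / d0)) /\
  (exists u, is_pos_solution phi c d h f lam u /\
     forall y B', 0 < B' -> (forall x, x <= y * W -> f_ext x <= B') ->
       Cst * phii (2 * (lam * B') * / d0) < 1 -> y <= sup_norm u).
Proof.
  intros Hlam HB HfB Hsmall. assert (HW := W_ge1).
  assert (Ha0 : 0 < a0) by (apply Rmin_glb_lt; lra).
  assert (HfB1 : forall x, x <= 1 -> f_ext x <= B) by (intros x Hx; apply HfB; lra).
  destruct (shooting_roots lam B Hlam HB HfB1 Hsmall) as [n0 [r [R1 [s1 [s2 [Hr [HR1 Hroots]]]]]]].
  split.
  - destruct (root_family_limit lam r 1 n0 s1 Hlam Hr Rlt_0_1 (fun n Hn => proj1 (Hroots n Hn)))
      as [u [Hu [Hup [_ Hpos]]]].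
    exists u. repeat split; try apply Hu; try assumption.
    apply Hup. intros n Hn. destruct (Hroots n Hn) as [[Hz [_ Hle]] _].
    apply (peak_bound lam B 1 n (s1 n) Hlam HB HfB1); lra.
  - destruct (root_family_limit lam 1 R1 n0 s2 Hlam Rlt_0_1 ltac:(lra) (fun n Hn => proj2 (Hroots n Hn)))
      as [u [Hu [_ [Hlow _]]]].
    exists u. split; [exact Hu |]. intros y B' HB' HfB' Hsm.
    assert (Hle1 : a0 <= a) by apply Rmin_l. assert (Hle2 : a0 <= 1 - b) by apply Rmin_r.
    assert (Hy : y * W <= W * sup_norm u).
    { apply (Hlow (y * W) ((a + b) / 2) a0 Ha0); [lra | lra |].
      intros n Hn. destruct (Hroots n Hn) as [_ [Hz [Hge _]]].
      apply Rnot_lt_le. intros Hc.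
      generalize (peak_bound lam B' (y * W) n (s2 n) Hlam HB' HfB' ltac:(lra) ltac:(lra)). lra. }
    apply Rmult_le_reg_l with W; lra.
Qed.

Lemma multiplicity : exists lam_star : R, 0 < lam_star /\
  exists U1 U2 : R -> R -> R,
    (forall lam, 0 < lam <= lam_star ->
       is_pos_solution phi c d h f lam (U1 lam) /\ is_pos_solution phi c d h f lam (U2 lam) /\
       0 < sup_norm (U1 lam) /\ sup_norm (U1 lam) < 1 /\ 1 < sup_norm (U2 lam)) /\
    (forall eps, 0 < eps -> exists delta, 0 < delta /\
       forall lam, 0 < lam < delta -> lam <= lam_star -> sup_norm (U1 lam) < eps) /\
    (forall y, exists delta, 0 < delta /\
       forall lam, 0 < lam < delta -> lam <= lam_star -> y < sup_norm (U2 lam)).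
Proof.
  assert (HC := Cst_pos). assert (HW := W_ge1).
  destruct (f_ext_bounded (2 * W)) as [B [HB HfB]].
  assert (Hthr : forall B' e, 0 < B' -> 0 < e -> 0 < d0 * phi (e / Cst) / (2 * B')).
  { intros B' e HB' He. apply Rdiv_lt_0_compat; [| lra].
    apply Rmult_lt_0_compat; [exact d0_pos | apply phi_pos, Rdiv_lt_0_compat; assumption]. }
  (* Half of the threshold in [small_parameter], so that the strict inequality still holds at
     [lam_star] itself. *)
  set (lam_star := d0 * phi (1 / Cst) / (2 * B) / 2).
  assert (Hls : 0 < lam_star) by (generalize (Hthr B 1 HB Rlt_0_1); unfold lam_star; lra).
  assert (Hsmall : forall lam, 0 < lam <= lam_star -> Cst * phii (2 * (lam * B) * / d0) < 1).
  { intros lam Hlam. apply small_parameter; [exact HB | lra |].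
    generalize (Hthr B 1 HB Rlt_0_1). unfold lam_star in *. lra. }
  set (P1 := fun lam u => is_pos_solution phi c d h f lam u /\ 0 < sup_norm u /\
     sup_norm u <= Cst * phii (2 * (lam * B) * / d0)).
  set (P2 := fun lam u => is_pos_solution phi c d h f lam u /\
     forall y B', 0 < B' -> (forall x, x <= y * W -> f_ext x <= B') ->
       Cst * phii (2 * (lam * B') * / d0) < 1 -> y <= sup_norm u).
  exists lam_star. split; [exact Hls |].
  exists (fun lam => epsilon (inhabits (fun _ => 0)) (P1 lam)),
    (fun lam => epsilon (inhabits (fun _ => 0)) (P2 lam)).
  assert (HP : forall lam, 0 < lam <= lam_star ->
    P1 lam (epsilon (inhabits (fun _ => 0)) (P1 lam)) /\
    P2 lam (epsilon (inhabits (fun _ => 0)) (P2 lam))).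
  { intros lam Hlam.
    destruct (two_solutions lam B ltac:(lra) HB HfB (Hsmall lam Hlam)) as [H1 H2].
    split; apply epsilon_spec; assumption. }
  split; [| split].
  - intros lam Hlam. destruct (HP lam Hlam) as [[Ha [Hb Hc]] [Hd He]].
    generalize (Hsmall lam Hlam). intros Hs.
    (* Level 2 rather than 1 gives the strict inequality for the second norm; [B] was taken as a
       bound up to [2 * W] for this purpose. *)
    assert (H2 := He 2 B HB HfB Hs).
    split; [exact Ha |]. split; [exact Hd |]. lra.
  - intros eps Heps. exists (d0 * phi (eps / Cst) / (2 * B)). split; [apply Hthr; assumption |].
    intros lam Hlam Hle. destruct (HP lam ltac:(lra)) as [[_ [_ Hc]] _].
    apply Rle_lt_trans with (1 := Hc). apply small_parameter; assumption.
  - intros y. destruct (f_ext_bounded ((y + 1) * W)) as [B' [HB' HfB']].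
    exists (d0 * phi (1 / Cst) / (2 * B')). split; [apply Hthr; lra |].
    intros lam Hlam Hle. destruct (HP lam ltac:(lra)) as [_ [_ He]].
    assert (y + 1 <= sup_norm (epsilon (inhabits (fun _ => 0)) (P2 lam))); [| lra].
    apply (He (y + 1) B' HB' HfB'). apply small_parameter; try assumption; lra.
Qed.

End Solutions.

End Problem.

Theorem theorem3p7 (phi psi1 psi2 psi1inv c d f h : R -> R) :
  standing phi psi1 psi2 psi1inv c d f h ->
  f0_infinite f phi -> finf_infinite f phi ->
  exists lam_star m_star : R, 0 < lam_star /\ 0 < m_star /\
  exists U1 U2 : R -> R -> R,
    (forall lam, 0 < lam < lam_star ->
       is_pos_solution phi c d h f lam (U1 lam) /\
       is_pos_solution phi c d h f lam (U2 lam) /\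
       0 < sup_norm (U1 lam) /\ sup_norm (U1 lam) < m_star /\
       m_star < sup_norm (U2 lam)) /\
    (forall eps, 0 < eps -> exists delta, 0 < delta /\
       forall lam, 0 < lam < delta -> lam < lam_star -> sup_norm (U1 lam) < eps) /\
    (forall M, exists delta, 0 < delta /\
       forall lam, 0 < lam < delta -> lam < lam_star -> M < sup_norm (U2 lam)) /\
    exists u, is_pos_solution phi c d h f lam_star u.
Proof.
  intros [Hphi [[Hp1 [Hp2 [_ Hp4]]] [[Hq1 _] [HA [Hinv [Hc [Hcp [Hd [Hdp [Hf [Hf0 [_ [Hh [Hh0
    [[t1 [Ht1 Hne]] [HL [HR _]]]]]]]]]]]]]]]]] Hf0inf Hfinf.
  destruct (odd_inc_homeo_inverse phi Hphi) as [phii [E1 [E2 [E3 [E4 E5]]]]].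
  destruct Hphi as [Hodd [Hincr _]].
  destruct (cont_on_pos_bounds c Hc Hcp) as [c0 [c1 [Hc0 Hcb]]].
  destruct (cont_on_pos_bounds d Hd Hdp) as [d0 [d1 [Hd0 Hdb]]].
  assert (Hopen : forall w, cont_on (fun t => 0 <= t <= 1) w -> forall t, 0 < t < 1 -> continuity_pt w t).
  { intros w Hw. apply cont_on_open. intros t Ht e He.
    destruct (Hw t ltac:(lra) e He) as [r [Hr H]]. exists r. split; [exact Hr |].
    intros x [Hx Hxr]. apply H. split; [lra | exact Hxr]. }
  assert (Hhc := cont_on_open h Hh).
  assert (Hcb' : forall t, 0 < t < 1 -> c0 <= c t <= c1) by (intros; apply Hcb; lra).
  assert (Hdb' : forall t, 0 < t < 1 -> d0 <= d t <= d1) by (intros; apply Hdb; lra).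
  assert (HLs := half_sums_controlled_left h psi1 psi1inv Hhc Hh0 (Hp1 0 ltac:(lra)) Hp2 Hinv HL).
  assert (HRs := half_sums_controlled_right h psi1 psi1inv Hhc Hh0 (Hp1 0 ltac:(lra)) Hp2 Hinv HR).
  destruct (slope_comparison phi psi1 psi2 c d phii c0 c1 d0 d1 Hodd E1 E2 E3 Hp4 HA Hc0 Hcb' Hd0 Hdb')
    as [K0 [HK0 Hcmp]].
  destruct (proj1 HLs) as [M1 [HM1 HM1']]. destruct (proj1 HRs) as [M2 [HM2 HM2']].
  assert (Hh1 : 0 < h t1) by (generalize (Hh0 t1 Ht1); lra).
  destruct (Hhc t1 Ht1 (h t1 / 2) ltac:(lra)) as [r [Hr Hball]].
  (* The half-width [q / 2] gives a closed interval around [t1] that avoids 0 and 1 and on which [h]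
     is at least half of [h t1]. *)
  set (q := Rmin r (Rmin t1 (1 - t1))).
  assert (Hq : 0 < q) by (repeat apply Rmin_glb_lt; lra).
  assert (Hqa : q <= r) by apply Rmin_l.
  assert (Hqb : q <= t1) by (apply Rle_trans with (1 := Rmin_r _ _), Rmin_l).
  assert (Hqc : q <= 1 - t1) by (apply Rle_trans with (1 := Rmin_r _ _), Rmin_r).
  assert (Hlow : forall t, t1 - q / 2 <= t <= t1 + q / 2 -> h t1 / 2 <= h t).
  { intros t Ht. destruct (Req_dec t t1) as [-> | Htne]; [lra |].
    specialize (Hball t). simpl in Hball. unfold R_dist in Hball.
    assert (Hd' : Rabs (h t - h t1) < h t1 / 2).
    { apply Hball. split; [split; [exact I | auto] | apply Rabs_def1; lra]. }
    apply Rabs_def2 in Hd'. lra. }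
  destruct (multiplicity phi psi1 psi2 psi1inv c d f h phii c0 c1 d0 d1 Hodd Hincr E1 E2 E3 E4 E5
    Hq1 HA Hinv Hc0 Hcb' Hd0 Hdb' (Hopen c Hc) (Hopen d Hd) Hf Hf0 Hhc Hh0 HLs HRs K0 HK0 Hcmp
    (Rmax M1 M2) (Rlt_le_trans _ _ _ HM1 (Rmax_l _ _))
    (fun n m Hm => Rle_trans _ _ _ (HM1' n m Hm) (Rmax_l _ _))
    (fun n m Hm => Rle_trans _ _ _ (HM2' n m Hm) (Rmax_r _ _))
    (t1 - q / 2) (t1 + q / 2) (h t1 / 2) ltac:(lra) ltac:(lra) ltac:(lra) Hlow Hf0inf Hfinf)
    as [ls [Hls [U1 [U2 [HU [HU1 HU2]]]]]].
  (* The value 1 is the level at which [shooting_roots] separates the two families of roots. *)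
  exists ls, 1. split; [exact Hls |]. split; [lra |]. exists U1, U2.
  split; [| split; [| split]].
  - intros lam Hlam. apply HU. lra.
  - intros eps He. destruct (HU1 eps He) as [delta [Hdel H]]. exists delta. split; [exact Hdel |].
    intros lam Hlam Hlt. apply H; lra.
  - intros y. destruct (HU2 y) as [delta [Hdel H]]. exists delta. split; [exact Hdel |].
    intros lam Hlam Hlt. apply H; lra.
  (* The parameter range of [multiplicity] is closed at its upper end. *)
  - exists (U1 ls). apply HU. lra.
Qed.
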